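(* Let $K$ be a field of any characteristic, and let $\eta$ be a finitely supported probability measure on $\mathrm{Aff}(K)^2$, supported on pairs $(g_1,g_2)$ with a common linear part $a(g_1)=a(g_2)$. Assume: (1) the common linear part is not almost surely a root of unity, i.e. $\eta\{g:\ a(g)\in\mu(K)\}<1$; (2) the support of $\eta$ is not included in the diagonal subgroup $\{(g,g): g\in \mathrm{Aff}(K)\}$ of $\mathrm{Aff}(K)^2$. Let $L_n=(L_{n,1},L_{n,2})$ be the random walk driven by $\eta$, and let $(a(L_n))$ be the projected random walk on $A$. Then: (i) If $(a(L_n))$ is transient, then almost surely there exists $n_0\in\mathbb{N}$ such that $\langle L_{n,1},L_{n,2}\rangle_+$ is free for every $n\ge n_0$. (ii) If $(a(L_n))$ is recurrent, then almost surely $\langle L_{n,1},L_{n,2}\rangle_+$ is not free for infinitely many $n$, but almost surely $$\frac1N\#\{1\le n\le N:\ \langle L_{n,1},L_{n,2}\rangle_+\text{ is not free}\}\longrightarrow 0\quad\text{as } N\to+\infty.$$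
   Context: For a field $K$, $\mathrm{Aff}(K)$ is the group of maps $x\mapsto ax+b$ of $K$ with $a\in K^\times$, $b\in K$, under composition. For $\gamma:x\mapsto ax+b$ write $a(\gamma):=a$ (the linear part). $\mu(K)$ is the group of roots of unity of $K$. For a subset $E$ of a group, $\langle E\rangle_{\mathrm{grp}}$ and $\langle E\rangle_+$ denote the subgroup and the subsemigroup generated by $E$. The measure $\eta$ is supported on pairs $g=(g_1,g_2)$ with $a(g_1)=a(g_2)$; for $g\in\langle\mathrm{supp}(\eta)\rangle_{\mathrm{grp}}$ write $a(g):=a(g_1)=a(g_2)$. $a_*\eta$ is the pushforward of $\eta$ to $K^\times$ under $a$, and $A=\langle\mathrm{supp}(a_*\eta)\rangle_{\mathrm{grp}}\subset K^\times$, a finitely generated abelian group. The random walk driven by $\eta$ is $L_n=X_n\cdots X_1$, where the $X_i$ are independent $\mathrm{Aff}(K)^2$-valued random variables of law $\eta$; write $L_n=(L_{n,1},L_{n,2})$. The walk $(a(L_n))$ on $A$ (started at $1$, driven by $a_*\eta$) is called recurrent if $\mathbb{P}(a(L_n)=1 \text{ for infinitely many } n)=1$, and transient otherwise. For $\alpha,\beta$ in a group, $\langle\alpha,\beta\rangle_+$ is said to be free (i.e. $\alpha$ and $\beta$ generate a free semigroup) if any two distinct non-empty words in the letters $\alpha$ and $\beta$ define distinct elements of the group. *)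

(* Defs.v *)
From HB Require Import structures.
From mathcomp Require Import all_boot all_order all_algebra finmap.
From mathcomp Require Import all_classical all_reals all_analysis.

Set Implicit Arguments.
Unset Strict Implicit.
Unset Printing Implicit Defensive.

Import GRing.Theory Num.Theory.

Local Open Scope classical_set_scope.
Local Open Scope ring_scope.

(* The map x |-> a * x + b is stored as the pair (a, b). *)
Record aff (K : fieldType) := Aff {
  aff_pair : K * K;
  aff_pair1_neq0 : aff_pair.1 != 0 }.

HB.instance Definition _ (K : fieldType) := [isSub for @aff_pair K].
HB.instance Definition _ (K : fieldType) := [Choice of aff K by <:].

Definition aff_lin (K : fieldType) (g : aff K) : K := (aff_pair g).1.
Definition aff_trans (K : fieldType) (g : aff K) : K := (aff_pair g).2.
Definition aff_fun (K : fieldType) (g : aff K) (x : K) : K :=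
  aff_lin g * x + aff_trans g.

Section AffGroup.
Context (K : fieldType).
Implicit Types g h : aff K.

Lemma aff_eq g h : aff_lin g = aff_lin h -> aff_trans g = aff_trans h -> g = h.
Proof.
move=> el et; apply: val_inj; move: el et.
by rewrite /aff_lin /aff_trans /=; case: (aff_pair g) (aff_pair h) => ? ? [? ?] /= -> ->.
Qed.

Lemma aff_lin_neq0 g : aff_lin g != 0.
Proof. exact: aff_pair1_neq0. Qed.

Definition aff_one : aff K := @Aff K (1, 0) (oner_neq0 K).

Definition aff_mul g h : aff K :=
  @Aff K (aff_lin g * aff_lin h, aff_lin g * aff_trans h + aff_trans g)
    (mulf_neq0 (aff_lin_neq0 g) (aff_lin_neq0 h)).

Definition aff_inv g : aff K :=
  @Aff K ((aff_lin g)^-1, - ((aff_lin g)^-1 * aff_trans g))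
    (invr_neq0 (aff_lin_neq0 g)).

Let mulA : associative aff_mul.
Proof.
move=> f g h; apply: aff_eq; rewrite /aff_lin /aff_trans /=.
  by rewrite mulrA.
by rewrite mulrDr !mulrA addrA.
Qed.

Let mul1 : left_id aff_one aff_mul.
Proof.
by move=> g; apply: aff_eq; rewrite /aff_lin /aff_trans /= !mul1r ?addr0.
Qed.

Let mulr1' : right_id aff_one aff_mul.
Proof.
by move=> g; apply: aff_eq; rewrite /aff_lin /aff_trans /= ?mulr1 // mulr0 add0r.
Qed.

Let mulV : left_inverse aff_one aff_inv aff_mul.
Proof.
move=> g; apply: aff_eq; rewrite /aff_lin /aff_trans /= ?mulVf ?subrr//.
exact: aff_lin_neq0.
Qed.

Let mulV' : right_inverse aff_one aff_inv aff_mul.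
Proof.
move=> g; have g0 := aff_lin_neq0 g.
apply: aff_eq; rewrite /aff_lin /aff_trans /= ?mulfV// mulrN mulrA mulfV//.
by rewrite mul1r addNr.
Qed.

HB.instance Definition _ :=
  isGroup.Build (aff K) mulA mul1 mulr1' mulV mulV'.

Lemma aff_funM g h : aff_fun (g * h)%g = aff_fun g \o aff_fun h.
Proof.
by apply/funext => x; rewrite /aff_fun /aff_lin /aff_trans /= mulrDr mulrA addrA.
Qed.

Lemma aff_fun_surj (a b : K) : a != 0 ->
  exists g : aff K, forall x, aff_fun g x = a * x + b.
Proof. by move=> a0; exists (@Aff K (a, b) a0). Qed.

Lemma aff_fun_inj : injective (@aff_fun K).
Proof.
move=> g h e; have e0 : aff_trans g = aff_trans h.
  by have := congr1 (@^~ 0) e; rewrite /aff_fun /= !mulr0 !add0r.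
apply: aff_eq => //; have := congr1 (@^~ 1) e.
by rewrite /aff_fun /= !mulr1 e0 => /addIr.
Qed.

HB.instance Definition _ := isPointed.Build (aff K) aff_one.
HB.instance Definition _ := @isMeasurable.Build default_measure_display
  (aff K) discrete_measurable discrete_measurable0
  discrete_measurableC discrete_measurableU.

End AffGroup.

(* The support, for a finitely supported measure on a space with measurable
   singletons such as aff K * aff K with the product sigma-algebra. *)
Definition supp (d : measure_display) (T : measurableType d) (R : realType)
  (mu : {measure set T -> \bar R}) : set T := [set x | mu [set x] != 0%E].

Definition finitely_supported (d : measure_display) (T : measurableType d)
    (R : realType) (mu : {measure set T -> \bar R}) : Prop :=
  exists2 S : set T, finite_set S & measurable S /\ mu (~` S) = 0%E.

Definition is_root_of_unity (K : fieldType) (x : K) : Prop :=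
  exists2 n : nat, (0 < n)%N & n.-unity_root x.

Definition word (G : groupType) (alpha beta : G) (w : seq bool) : G :=
  (\prod_(b <- w) (if b then alpha else beta))%g.

Definition free_semigroup (G : groupType) (alpha beta : G) : Prop :=
  forall u v : seq bool, u != [::] -> v != [::] -> u != v ->
    word alpha beta u <> word alpha beta v.

Definition mutually_independent (d d' : measure_display) (T : measurableType d)
    (T' : measurableType d') (R : realType) (P : probability T R)
    (I : choiceType) (X : I -> {RV P >-> T'}) : Prop :=
  forall (J : {fset I}) (B : I -> set T'),
    (forall i, i \in J -> measurable (B i)) ->
    P (\bigcap_(i in [set` J]) (X i @^-1` B i)) =
    (\prod_(i <- J) P (X i @^-1` B i))%E.

(* X 0, X 1, ... are the steps X_1, X_2, ...: walk X n = X_n ... X_1. *)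
Fixpoint walk (G : groupType) (T : Type) (X : nat -> T -> G) (n : nat) (w : T)
    : G :=
  if n is m.+1 then (X m w * walk X m w)%g else 1%g.

(* "Almost surely" is {ae P, _}, which does not require the event to be
   measurable: the steps may take arbitrary values on a P-negligible set, so
   events about products of steps are only measurable up to negligible sets. *)
Definition recurrent (d : measure_display) (T : measurableType d)
    (R : realType) (P : probability T R) (K : fieldType) (Y : nat -> T -> K)
    : Prop :=
  {ae P, forall w, infinite_set [set n | Y n w = 1]}.

Definition transient (d : measure_display) (T : measurableType d)
    (R : realType) (P : probability T R) (K : fieldType) (Y : nat -> T -> K)
    : Prop :=
  ~ recurrent P Y.

(* Main.v *)
Require Import Defs.
From mathcomp Require Import all_boot all_order all_algebra finmap ring lra zify.
From mathcomp Require Import all_classical all_reals all_analysis.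
Set Implicit Arguments.
Unset Strict Implicit.
Unset Printing Implicit Defensive.
Import Order.TTheory GRing.Theory Num.Theory.
Import numFieldNormedType.Exports.
Local Open Scope classical_set_scope.
Local Open Scope ring_scope.

(** Two affine maps [x |-> a x + b] and [x |-> a x + b'] fail to generate a free
semigroup only if [b = b'] or [a] is a root of a nonzero polynomial with
coefficients in [{-1, 0, 1}] (a height-one root): that polynomial is the
difference of the two words ([free_semigroup_aff]).  Applied to the walk, this
splits the question in two.

The linear part.  A finitely generated subgroup of [K^*] contains only finitely
many height-one roots ([finite_height1_root]).  They generate a group inside a
finitely generated ring, and two of them that agree modulo 5 are equal: if
[x - y = 5 w], the coordinates of [5^n w^n = (x - y)^n] are [O(4^n)], so [w^n]
vanishes for large [n].  In positive characteristic the ring is finite.  Hence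
non-freeness through the linear part means a visit of the walk [a(L_n)] to a
finite set.  If that walk is transient, its Green function is bounded and the
visits stop ([transient_leaves_list]).  In all cases the first [N] laws of the
walk have an average of squared l2 norm [O(N^(-1/3))] ([cesaro_law_le]), so the
visits have density zero, by Borel-Cantelli along the times [64^j]
([rare_visits], [density_cvg0]).

The translation part.  The difference of the two translation parts of [L_n] is
the image of 0 under a random walk of affine maps [x |-> a x + (b - b')]
([diff_aff]).  If the steps of this walk commute, they have a common fixed
point, which is nonzero because of the off-diagonal step, and fixing 0 as well
forces [a(L_n) = 1].  Otherwise the steps generate a free semigroup, so words of
length [n] have exponentially many values ([affine_exponential_growth]).  The
Nash inequality then makes the l2 norm of the law of the lazy walk decay faster
than any power of [n] ([lazy_sqnorm_decay]).  Maps that fix 0 are determined by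
their linear part, which takes only polynomially many values in [n] steps, so
the lazy walk fixes 0 a summable number of times; the walk itself spends half
that expected time there ([visits_summable]).  In this case the translation
parts coincide only finitely often, almost surely.

Altogether, almost surely and for all large [n], non-freeness implies that
[a(L_n)] is a height-one root ([eventually_height1]). *)

(** * Height-one roots in a finitely generated multiplicative group *)

Section Algebra.
Context (K : fieldType).
Implicit Types (x y z : K) (E G : K -> Prop) (s bs ms : seq K).

Definition height1_root z := exists p : {poly int},
  [/\ p != 0, forall i, `|p`_i| <= 1 & (map_poly intr p).[z] = 0].

Lemma horner_map_intr (p : {poly int}) n x : (size p <= n)%N ->
  (map_poly intr p).[x] = \sum_(i < n) (p`_i)%:~R * x ^+ i.
Proof.
move=> szp; rewrite (horner_coef_wide _ (leq_trans (size_poly _ _) szp)).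
by apply: eq_bigr => i _; rewrite coef_map.
Qed.

(** The reversed polynomial vanishes at the inverse. *)
Lemma height1_rootV z : z != 0 -> height1_root z -> height1_root z^-1.
Proof.
move=> z0 [p [p0 p1 pz]].
pose q : {poly int} := \poly_(i < size p) p`_((size p).-1 - i).
have sp : (0 < size p)%N by rewrite lt0n size_poly_eq0.
exists q; split.
- apply: contraNneq p0 => q0; rewrite -lead_coef_eq0 lead_coefE.
  by have := congr1 (fun r : {poly int} => r`_0) q0; rewrite coef_poly sp subn0 coef0 => ->.
- by move=> i; rewrite coef_poly; case: ifP => // _; rewrite normr0.
have := congr1 ( *%R (z^-1 ^+ (size p).-1)) pz; rewrite mulr0 => <-.
rewrite !(horner_map_intr (n := size p)) ?size_poly// mulr_sumr (reindex_inj rev_ord_inj)/=.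
apply: eq_bigr => i _; rewrite coef_poly.
have -> : (size p - i.+1 < size p)%N by rewrite ltn_subrL sp.
have -> : ((size p).-1 - (size p - i.+1))%N = i.
  by move: (ltn_ord i); set m := size p; move: (nat_of_ord i) => a; lia.
rewrite mulrCA; congr (_ * _).
have -> : (size p).-1 = (size p - i.+1 + i)%N.
  by move: (ltn_ord i); set m := size p; move: (nat_of_ord i) => a; lia.
by rewrite exprD -mulrA -exprMn mulVf// expr1n mulr1.
Qed.

(** The leading coefficient is a unit, so [z] is integral.  Multiplying by [z] and
reducing the top term changes each coefficient by at most the previous top
coefficient, so the coefficients at most double.  This takes the place of the
bound [|z| < 2] on the complex conjugates of [z]. *)
Lemma height1_root_powers z : height1_root z -> exists d, forall n, exists c : nat -> int,
  (forall l, `|c l| <= 2 ^+ n) /\ z ^+ n = \sum_(l < d) (c l)%:~R * z ^+ l.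
Proof.
move=> [p [p0 p1 pz]].
have sp : (0 < size p)%N by rewrite lt0n size_poly_eq0.
pose d := (size p).-1.
have l1 : p`_d = 1 \/ p`_d = -1.
  have := p1 d; have : p`_d != 0 by rewrite -lead_coefE lead_coef_eq0.
  by move: p`_d => a; lia.
have rel : z ^+ d = \sum_(l < d) (- p`_d * p`_l)%:~R * z ^+ l.
  have szd : (size p <= d.+1)%N by rewrite /d prednK.
  move: pz; rewrite (horner_map_intr _ szd) big_ord_recr/= => /eqP.
  rewrite addrC addr_eq0 => /eqP e.
  under eq_bigr => i _ do rewrite intrM -mulrA.
  rewrite -mulr_sumr.
  rewrite -mulrN1 intrM -mulrA mulN1r -e mulrA -intrM.
  by case: l1 => ->; rewrite ?mulrNN mulr1 mul1r.
have c1 l : `|- p`_d * p`_l| <= 1.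
  rewrite normrM normrN; have := p1 l; have := p1 d; move: `|p`_d| (normr_ge0 p`_d) => a a0.
  by move: `|p`_l| (normr_ge0 p`_l) => b b0; nia.
have d0 : (0 < d)%N.
  rewrite lt0n; apply/negP => /eqP dd; move: rel; rewrite dd big_ord0 expr0 => /eqP.
  by rewrite oner_eq0.
have [d' dE] : exists d', d = d'.+1 by exists d.-1; rewrite prednK.
rewrite dE in rel c1.
exists d'.+1; elim=> [|n [c [cb cE]]].
  exists (fun l => (l == 0%N)%:R); split => [l|]; first by case: eqP.
  rewrite big_ord_recl/= !expr0 mulr1 big1 ?addr0// => i _.
  by rewrite mul0r.
exists (fun l => (if l is l'.+1 then c l' else 0) + c d' * (- p`_d'.+1 * p`_l)); split.
  move=> l; apply: le_trans (ler_normD _ _) _.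
  have -> : 2 ^+ n.+1 = 2 ^+ n + 2 ^+ n :> int by rewrite exprS; lia.
  apply: lerD; first by case: l => [|l]; rewrite ?normr0 ?exprn_ge0.
  rewrite normrM; apply: le_trans (cb d').
  by rewrite ler_piMr.
rewrite exprS cE mulr_sumr.
under eq_bigr => i _ do rewrite mulrCA -exprS.
rewrite big_ord_recr/= rel mulr_sumr.
under [in RHS]eq_bigr => i _ do rewrite intrD mulrDl.
rewrite big_split/=; congr (_ + _).
  by rewrite big_ord_recl/= mul0r add0r.
by apply: eq_bigr => i _; rewrite mulrA -intrM.
Qed.


Inductive gen E : K -> Prop :=
| gen1 : gen E 1
| gen_stepM x y : E x -> gen E y -> gen E (x * y)
| gen_stepV x y : E x -> gen E y -> gen E (x^-1 * y).

Definition mul_subgroup G :=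
  [/\ G 1, forall x y, G x -> G y -> G (x * y) & forall x, G x -> G x^-1].

Lemma gen_subgroup E : mul_subgroup (gen E).
Proof.
split; first exact: gen1.
- move=> x y gx gy; elim: gx => [|u v Eu _ IH|u v Eu _ IH]; first by rewrite mul1r.
    by rewrite -mulrA; apply: gen_stepM.
  by rewrite -mulrA; apply: gen_stepV.
- move=> x; elim=> [|u v Eu _ IH|u v Eu _ IH]; rewrite ?invr1 ?invfM; first exact: gen1.
    exact: gen_stepV.
  by rewrite invrK; apply: gen_stepM.
Qed.

Lemma gen_sub_subgroup E G : mul_subgroup G -> (forall x, E x -> G x) ->
  forall x, gen E x -> G x.
Proof.
move=> [G1 GM GV] EG x; elim=> [//|u v Eu _ IH|u v Eu _ IH]; apply: GM => //.
  exact: EG.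
by apply/GV/EG.
Qed.

Lemma mem_gen E x : E x -> gen E x.
Proof. by move=> Ex; rewrite -[x]mulr1; apply: gen_stepM => //; exact: gen1. Qed.

Lemma gen_mono E E' x : (forall y, E y -> E' y) -> gen E x -> gen E' x.
Proof.
move=> EE'; apply: gen_sub_subgroup; first exact: gen_subgroup.
by move=> y /EE'; apply: mem_gen.
Qed.

Lemma gen_neq0 E x : (forall y, E y -> y != 0) -> gen E x -> x != 0.
Proof.
move=> E0; elim=> [|u v Eu _ v0|u v Eu _ v0]; first exact: oner_neq0.
  by rewrite mulf_neq0// E0.
by rewrite mulf_neq0// invr_neq0// E0.
Qed.

Lemma mul_subgroupX G x (n : int) : mul_subgroup G -> G x -> G (x ^ n).
Proof.
move=> [G1 GM GV] Gx.
have GX k : G (x ^+ k) by elim: k => [|k IH]; rewrite ?expr0// exprS; apply: GM.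
by case: n => n; [apply: GX | apply/GV/GX].
Qed.

(** Only finitely many elements of [E] enter a given product. *)
Lemma gen_compact E x : gen E x ->
  exists2 s : seq K, (forall y, y \in s -> E y) & gen (fun y => y \in s) x.
Proof.
elim=> [|u v Eu _ [s sE gs]|u v Eu _ [s sE gs]].
- by exists [::] => //; apply: gen1.
- exists (u :: s) => [y|]; first by rewrite inE => /orP[/eqP->//|/sE].
  apply: gen_stepM; first by rewrite inE eqxx.
  by apply: gen_mono gs => y ys; rewrite inE ys orbT.
- exists (u :: s) => [y|]; first by rewrite inE => /orP[/eqP->//|/sE].
  apply: gen_stepV; first by rewrite inE eqxx.
  by apply: gen_mono gs => y ys; rewrite inE ys orbT.
Qed.

Lemma gen_cons c s x : c != 0 -> gen (fun y => y \in c :: s) x ->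
  exists (n : int) y, x = c ^ n * y /\ gen (fun y => y \in s) y.
Proof.
move=> c0; elim=> [|u v + _ [n [y [-> gy]]]|u v + _ [n [y [-> gy]]]].
- by exists 0, 1; rewrite expr0z mul1r; split => //; apply: gen1.
- rewrite inE => /orP[/eqP->|us].
    by exists (1 + n), y; rewrite expfzDr// expr1z mulrA.
  by exists n, (u * y); rewrite mulrCA; split => //; apply: gen_stepM.
- rewrite inE => /orP[/eqP->|us].
    by exists (-1 + n), y; rewrite expfzDr// exprN1 mulrA.
  by exists n, (u^-1 * y); rewrite mulrCA; split => //; apply: gen_stepV.
Qed.

(** Finitely generated abelian groups are Noetherian.  Induction on the list of
generators [c :: s]: the exponents of [c] on the elements of [G] form a subgroup
of the integers, generated by its least positive element [d] if it is not zero;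
an element of exponent [d], together with generators of the elements of exponent
0, generates [G]. *)
Lemma subgroup_finitely_generated s G : (forall c, c \in s -> c != 0) ->
  mul_subgroup G -> (forall x, G x -> gen (fun y => y \in s) x) ->
  exists2 bs : seq K, (forall b, b \in bs -> G b) &
    forall x, G x -> gen (fun y => y \in bs) x.
Proof.
elim: s G => [|c s IH] G s0 Gsub Gs; first by exists [::].
have c0 : c != 0 by apply: s0; rewrite inE eqxx.
have {}s0 y : y \in s -> y != 0 by move=> ys; apply: s0; rewrite inE ys orbT.
have ssub := gen_subgroup (fun y => y \in s).
case: (Gsub) (ssub) => [G1 GM GV] [g1 gM gV].
pose D (n : nat) := `[< (0 < n)%N /\ exists2 y, gen (fun y => y \in s) y & G (c ^+ n * y) >].
have [exD|nD] := pselect (exists n, D n); last first.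
  apply: IH => // x Gx; have [n [y [xE gy]]] := gen_cons c0 (Gs _ Gx).
  case: n xE => [[|n]|n] xE.
  - by rewrite xE expr0z mul1r.
  - by case: nD; exists n.+1; apply/asboolP; split => //; exists y; rewrite // -exprnP in xE *; rewrite -xE.
  - case: nD; exists n.+1; apply/asboolP; split => //; exists y^-1; first exact: gV.
    by have := GV _ Gx; rewrite xE invfM NegzE -exprnN invrK.
have [d /asboolP[d0 [yd gyd Gyd]] dmin] := ex_minnP exD.
pose G' x := G x /\ gen (fun y => y \in s) x.
have [|x []//|bs bsG' G'bs] := IH G' s0.
  split => //; first by move=> x y [? ?] [? ?]; split; [apply: GM | apply: gM].
  by move=> x [? ?]; split; [apply: GV | apply: gV].
exists (c ^+ d * yd :: bs) => [b|x Gx].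
  by rewrite inE => /orP[/eqP->//|/bsG'[]].
have [n [y [xE gy]]] := gen_cons c0 (Gs _ Gx).
set xd := c ^+ d * yd in Gyd *.
pose k := (n %/ d%:Z)%Z.
have dz : d%:Z != 0 by rewrite -lt0n; case: (d) d0.
have rE : (n %% d%:Z)%Z = `|(n %% d%:Z)%Z|%N :> int by rewrite gez0_abs// modz_ge0.
have wE : x * xd ^ (- k) = c ^+ `|(n %% d%:Z)%Z|%N * (y * yd ^ (- k)).
  rewrite xE /xd !exprnP -rE expfzMl exprz_exp mulrACA -expfzDr//; congr (c ^ _ * _).
  by rewrite /modz -/k mulrN mulrC.
have Gw : G (x * xd ^ (- k)) by apply: GM => //; apply: mul_subgroupX.
have gw : gen (fun y => y \in s) (y * yd ^ (- k)) by apply: gM => //; apply: mul_subgroupX.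
have r0 : `|(n %% d%:Z)%Z|%N = 0%N.
  apply/eqP; rewrite -leqn0 leqNgt; apply/negP => r0.
  have : (d <= `|(n %% d%:Z)%Z|%N)%N.
    by apply: dmin; apply/asboolP; split => //; exists (y * yd ^ (- k)) => //; rewrite -wE.
  by rewrite leqNgt -ltz_nat -rE ltz_pmod.
have G'w : G' (x * xd ^ (- k)) by split => //; rewrite wE r0 expr0 mul1r.
have [b1 bM bV] := gen_subgroup (fun y => y \in xd :: bs).
have -> : x = x * xd ^ (- k) * xd ^ k.
  have xd0 : xd != 0 by rewrite mulf_neq0 ?expf_neq0//; apply: gen_neq0 gyd.
  by rewrite -mulrA -expfzDr// addNr expr0z mulr1.
apply: bM; last first.
  by apply: mul_subgroupX; [exact: gen_subgroup | apply: mem_gen; rewrite inE eqxx].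
by apply: gen_mono (G'bs _ G'w) => z zbs; rewrite inE zbs orbT.
Qed.

(** The generators are taken in [E] itself: for height-one roots this is what makes
them integral. *)
Lemma gen_finite_basis s E : (forall c, c \in s -> c != 0) ->
  (forall x, E x -> gen (fun y => y \in s) x) ->
  exists2 bs : seq K, (forall b, b \in bs -> E b) &
    forall x, E x -> gen (fun y => y \in bs) x.
Proof.
move=> s0 Es.
have [||bs bsE Ebs] := @subgroup_finitely_generated s (gen E) s0.
- exact: gen_subgroup.
- by apply: gen_sub_subgroup => //; apply: gen_subgroup.
have [cs csE bscs] : exists2 cs : seq K, (forall b, b \in cs -> E b) &
    forall b, b \in bs -> gen (fun y => y \in cs) b.
  elim: bs bsE {Ebs} => [|b bs IH] bsE; first by exists [::].
  have [|cs csE bscs] := IH; first by move=> x xbs; apply: bsE; rewrite inE xbs orbT.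
  have [t tE bt] := gen_compact (bsE b (mem_head _ _)).
  exists (t ++ cs) => [x|x]; first by rewrite mem_cat => /orP[/tE|/csE].
  rewrite inE => /orP[/eqP->|xbs].
    by apply: gen_mono bt => y yt; rewrite mem_cat yt.
  by apply: gen_mono (bscs _ xbs) => y yt; rewrite mem_cat yt orbT.
exists cs => // x Ex.
apply: gen_sub_subgroup bscs _ (Ebs x (mem_gen Ex)).
exact: gen_subgroup.
Qed.


Definition zspan ms x :=
  exists c : nat -> int, x = \sum_(i < size ms) (c i)%:~R * ms`_i.

Lemma zspan0 ms : zspan ms 0.
Proof. by exists (fun=> 0); rewrite big1// => i _; rewrite mul0r. Qed.

Lemma zspanD ms x y : zspan ms x -> zspan ms y -> zspan ms (x + y).
Proof.
move=> [c ->] [c' ->]; exists (fun i => c i + c' i).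
by rewrite -big_split; apply: eq_bigr => i _; rewrite intrD mulrDl.
Qed.

Lemma zspanZ ms (n : int) x : zspan ms x -> zspan ms (n%:~R * x).
Proof.
move=> [c ->]; exists (fun i => n * c i).
by rewrite mulr_sumr; apply: eq_bigr => i _; rewrite intrM mulrA.
Qed.

Lemma zspan_mem ms m : m \in ms -> zspan ms m.
Proof.
move=> mms; exists (fun i => (i == index m ms)%:R).
have im : (index m ms < size ms)%N by rewrite index_mem.
rewrite (bigD1 (Ordinal im))//= eqxx mul1r nth_index// big1 ?addr0// => i.
by rewrite -val_eqE/= => /negPf ->; rewrite mul0r.
Qed.

Lemma zspan_sum ms n (F : 'I_n -> K) :
  (forall i, zspan ms (F i)) -> zspan ms (\sum_i F i).
Proof. by move=> H; elim/big_ind: _ => //; [exact: zspan0 | move=> *; apply: zspanD]. Qed.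

Lemma zspan_trans ms ms' x :
  (forall m, m \in ms -> zspan ms' m) -> zspan ms x -> zspan ms' x.
Proof.
move=> H [c ->]; apply: zspan_sum => i; apply: zspanZ; apply: H.
exact: mem_nth.
Qed.

Lemma zspanM ms ms' x y : zspan ms x -> zspan ms' y ->
  zspan [seq m * m' | m <- ms, m' <- ms'] (x * y).
Proof.
move=> [c ->] [c' ->]; rewrite mulr_suml; apply: zspan_sum => i.
rewrite mulr_sumr; apply: zspan_sum => j.
rewrite mulrACA -intrM; apply: zspanZ; apply: zspan_mem.
by apply: allpairs_f; apply: mem_nth.
Qed.

(** Both [z] and its inverse are integral, so nonnegative and negative powers lie in
two finitely generated modules. *)
Lemma height1_root_zspan z : z != 0 -> height1_root z ->
  exists2 ms : seq K, (forall m, m \in ms -> exists n : int, m = z ^ n) &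
    forall n : int, zspan ms (z ^ n).
Proof.
move=> z0 hz.
have [d Hd] := height1_root_powers hz.
have [d' Hd'] := height1_root_powers (height1_rootV z0 hz).
exists ([seq z ^+ l | l <- iota 0 d] ++ [seq z^-1 ^+ l | l <- iota 0 d']).
  move=> m; rewrite mem_cat => /orP[] /mapP[l _ ->].
    by exists l%:Z.
  by exists (- l%:Z); rewrite -exprnN exprVn.
case=> n.
  have [c [_ E]] := Hd n; rewrite -exprnP E.
  apply: zspan_sum => i; apply: zspanZ; apply: zspan_mem.
  by rewrite mem_cat map_f// mem_iota/=.
have [c [_ E]] := Hd' n.+1; rewrite NegzE -exprnN -exprVn E.
apply: zspan_sum => i; apply: zspanZ; apply: zspan_mem.
by rewrite mem_cat orbC map_f// mem_iota/=.
Qed.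

(** The spanning list consists of elements of the group, so the module it spans is a
ring. *)
Lemma gen_height1_zspan bs : (forall b, b \in bs -> b != 0 /\ height1_root b) ->
  exists2 ms : seq K, (forall m, m \in ms -> gen (fun y => y \in bs) m) &
    forall x, gen (fun y => y \in bs) x -> zspan ms x.
Proof.
elim: bs => [|b bs IH] H.
  exists [:: 1]; first by move=> m; rewrite inE => /eqP ->; apply: gen1.
  move=> x gx; have -> : x = 1; last by apply: zspan_mem; rewrite inE.
  apply: (gen_sub_subgroup (G := fun z => z = 1)) gx => //.
  by split => // [? ? -> ->|? ->]; rewrite ?mul1r ?invr1.
have [|ms2 ms2g Hms2] := IH; first by move=> c cbs; apply: H; rewrite inE cbs orbT.
have [b0 hb] := H b (mem_head _ _).
have [ms1 ms1g Hms1] := height1_root_zspan b0 hb.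
have [_ gM _] := gen_subgroup (fun y => y \in b :: bs).
exists [seq m * m' | m <- ms1, m' <- ms2].
  move=> m /allpairsP[[m1 m2]/= [/ms1g[n ->] /ms2g gm2 ->]].
  apply: gM; last by apply: gen_mono gm2 => y ybs; rewrite inE ybs orbT.
  by apply: mul_subgroupX; [exact: gen_subgroup | apply: mem_gen; rewrite inE eqxx].
by move=> x /(gen_cons b0)[n [y [-> gy]]]; apply: zspanM; [apply: Hms1 | apply: Hms2].
Qed.

(** A maximal independent family [b]; the denominators of the other elements are
collected in [q]. *)
Lemma zspan_coordinates ms : exists (b : seq K) (q : int) (c : nat -> nat -> int),
  [/\ q != 0,
      forall e : nat -> int, \sum_(h < size b) (e h)%:~R * b`_h = 0 ->
        forall h, (h < size b)%N -> e h = 0 &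
      forall k, (k < size ms)%N ->
        q%:~R * ms`_k = \sum_(h < size b) (c k h)%:~R * b`_h].
Proof.
elim: ms => [|m ms [b [q [c [q0 bfree cE]]]]].
  by exists [::], 1, (fun _ _ => 0); split.
have [[r [e [r0 rm]]]|nrel] := pselect (exists (r : int) (e : nat -> int),
    r != 0 /\ r%:~R * m = \sum_(h < size b) (e h)%:~R * b`_h).
  exists b, (q * r), (fun k h => if k is k'.+1 then r * c k' h else q * e h).
  split => //; first by rewrite mulf_neq0.
  case=> [_|k kms] /=.
    rewrite intrM -mulrA rm mulr_sumr; apply: eq_bigr => i _.
    by rewrite intrM mulrA.
  rewrite mulrC (mulrC q) intrM mulrC -mulrA cE// mulr_sumr.
  by apply: eq_bigr => i _; rewrite intrM mulrA.
exists (m :: b), q, (fun k h => match k, h with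
  | 0%N, 0%N => q | k'.+1, h'.+1 => c k' h' | _, _ => 0 end); split => //.
  move=> e; rewrite /= big_ord_recl/= => /eqP; rewrite addr_eq0 => /eqP e0.
  have e00 : e 0%N = 0.
    apply: contrapT => /eqP e00; apply: nrel; exists (e 0%N), (fun h => - e h.+1).
    split => //; rewrite e0 -sumrN; apply: eq_bigr => i _.
    by rewrite intrN mulNr.
  move: e0; rewrite e00 mul0r => /esym/eqP; rewrite oppr_eq0 => /eqP e0.
  by case=> // h hb; apply: (bfree (fun h => e h.+1)).
case=> [_|k kms] /=; rewrite big_ord_recl/=.
  by rewrite big1 ?addr0// => i _; rewrite mul0r.
by rewrite mul0r add0r cE.
Qed.

Section Characteristic0.
Hypothesis K0 : forall n, (0 < n)%N -> n%:R != 0 :> K.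

Let intr_neq0 (n : int) : n != 0 -> n%:~R != 0 :> K.
Proof.
case: n => n n0; first by apply: K0; rewrite lt0n.
by rewrite NegzE intrN oppr_eq0 K0.
Qed.

(** Discreteness of a finitely generated module: if [N w] has coordinates small
compared with [N], the integer coordinates of [w] are less than 1 in absolute
value. *)
Lemma zspan_small ms : exists B : nat, forall (N M : nat) w (e : nat -> int),
  zspan ms w -> N%:R * w = \sum_(k < size ms) (e k)%:~R * ms`_k ->
  (forall k, `|e k| <= M%:Z) -> (M * B < N)%N -> w = 0.
Proof.
have [b [q [c [q0 bfree cE]]]] := zspan_coordinates ms.
exists (\sum_(k < size ms) \sum_(h < size b) `|c k h|)%N => N M w e [f wE] NwE eM MBN.
have qE (g : nat -> int) : q%:~R * (\sum_(k < size ms) (g k)%:~R * ms`_k) =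
    \sum_(h < size b) (\sum_(k < size ms) g k * c k h)%:~R * b`_h.
  rewrite mulr_sumr.
  under [RHS]eq_bigr => h _ do rewrite rmorph_sum/= mulr_suml.
  rewrite exchange_big/=; apply: eq_bigr => k _.
  by rewrite mulrCA cE// mulr_sumr; apply: eq_bigr => h _; rewrite intrM mulrA.
pose F h := \sum_(k < size ms) f k * c k h.
pose E h := \sum_(k < size ms) e k * c k h.
have FE h : (h < size b)%N -> N%:Z * F h - E h = 0.
  apply: (bfree (fun h => N%:Z * F h - E h)).
  transitivity (N%:R * (q%:~R * w) - q%:~R * (N%:R * w)); last first.
    by rewrite mulrCA subrr.
  rewrite {1}wE NwE !qE mulr_sumr -sumrB; apply: eq_bigr => i _.
  by rewrite intrB intrM mulrBl mulrA.
have F0 h : (h < size b)%N -> F h = 0.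
  move=> hb; apply/eqP; rewrite -absz_eq0 -leqn0 -ltnS; apply: contraT; rewrite -leqNgt => F1.
  have : (`|E h| < N)%N.
    apply: leq_ltn_trans MBN.
    apply: (@leq_trans (\sum_(k < size ms) M * `|c k h|)%N).
      rewrite -lez_nat abszE; apply: le_trans (ler_norm_sum _ _ _) _.
      rewrite -[leRHS]intz sumMz; apply: ler_sum => k _.
      by rewrite intz normrM PoszM; apply: ler_pM.
    rewrite -big_distrr/= leq_mul2l; apply/orP; right; apply: leq_sum => k _.
    by rewrite (bigD1 (Ordinal hb))//= leq_addr.
  have /eqP := FE h hb; rewrite subr_eq0 => /eqP <-.
  by rewrite abszM absz_nat ltnNge leq_pmulr.
have : q%:~R * w = 0.
  by rewrite wE qE big1// => h _; rewrite -/(F h) F0// mul0r.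
by move/eqP; rewrite mulf_eq0 (negPf (intr_neq0 q0)) => /eqP.
Qed.

End Characteristic0.


Lemma pow4_lt_pow5 B : exists j, (4 ^ j * B < 5 ^ j)%N.
Proof.
(* Bernoulli's inequality for (5/4)^j *)
exists (4 * B)%N.
have H j : (4 ^ j * (4 + j) <= 4 * 5 ^ j)%N.
  elim: j => // j IH; rewrite [(5 ^ _)%N]expnS [(4 ^ j.+1)%N]expnS.
  move: (4 ^ j)%N (5 ^ j)%N IH => a b; nia.
have := H (4 * B)%N; have : (0 < 4 ^ (4 * B))%N by rewrite expn_gt0.
move: (4 ^ _)%N (5 ^ _)%N => a b; nia.
Qed.

(** In the binomial expansion both [x ^ (n - i)] and [y ^ i] have coefficients bounded
by the corresponding powers of 2, and [(2 + 2) ^ n = 4 ^ n]. *)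
Lemma height1_root_subX x y : height1_root x -> height1_root y ->
  exists d d', forall n, exists c : nat -> nat -> int,
  (forall l l', `|c l l'| <= 4 ^+ n) /\
  (x - y) ^+ n = \sum_(l < d) \sum_(l' < d') (c l l')%:~R * (x ^+ l * y ^+ l').
Proof.
move=> /height1_root_powers[d Hd] /height1_root_powers[d' Hd'].
have [cx /all_and2[cxb cxE]] := choice Hd.
have [cy /all_and2[cyb cyE]] := choice Hd'.
exists d, d' => n.
exists (fun l l' => \sum_(i < n.+1) (-1) ^+ i * cx (n - i)%N l * cy i l' *+ 'C(n, i)).
split=> [l l'|].
  apply: le_trans (ler_norm_sum _ _ _) _.
  have -> : 4 ^+ n = (2 + 2) ^+ n :> int by [].
  rewrite exprDn.
  apply: ler_sum => i _; rewrite normrMn lerMn2r; apply/orP; right.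
  rewrite !normrM normrX normrN1 expr1n mul1r.
  exact: ler_pM.
rewrite exprBn.
under [RHS]eq_bigr => l _ do under eq_bigr => l' _ do rewrite rmorph_sum/= mulr_suml.
under [RHS]eq_bigr => l _ do rewrite exchange_big/=.
rewrite exchange_big/=; apply: eq_bigr => i _.
rewrite cxE cyE -mulrA mulr_suml mulr_sumr -sumrMnl; apply: eq_bigr => l _.
rewrite mulr_sumr mulr_sumr -sumrMnl; apply: eq_bigr => l' _.
rewrite rmorphMn/= mulrnAl; congr (_ *+ _).
by rewrite !intrM rmorphXn/= rmorphN1 mulrACA !mulrA.
Qed.

(** The element [5 ^ n w ^ n = (x - y) ^ n] has coefficients [O(4 ^ n)] while [w ^ n]
stays in a discrete module, so [w ^ n = 0] for [n] large.  Any integer above 4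
could replace 5. *)
Lemma height1_root_congr_eq (K0 : forall n, (0 < n)%N -> n%:R != 0 :> K) ms x y w :
  (forall m m', m \in ms -> m' \in ms -> zspan ms (m * m')) -> zspan ms 1 ->
  (forall l l', zspan ms (x ^+ l * y ^+ l')) ->
  height1_root x -> height1_root y -> zspan ms w -> x - y = 5%:R * w -> x = y.
Proof.
move=> msM ms1 msxy hx hy msw xyw.
have mswX j : zspan ms (w ^+ j).
  elim: j => [//|j IH]; rewrite exprS.
  apply: zspan_trans (zspanM msw IH) => m /allpairsP[[a b]/= [? ? ->]].
  exact: msM.
have [B HB] := zspan_small K0 ms.
have [d [d' Hc]] := height1_root_subX hx hy.
pose g l l' := projT1 (cid (msxy l l')).
have gE l l' : x ^+ l * y ^+ l' = \sum_(k < size ms) (g l l' k)%:~R * ms`_k.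
  exact: projT2 (cid (msxy l l')).
pose G := (\sum_(l < d) \sum_(l' < d') \sum_(k < size ms) `|g l l' k|)%N.
have [j Hj] := pow4_lt_pow5 (G * B).
have [c [cb cE]] := Hc j.
have : w ^+ j = 0.
  apply: (HB (5 ^ j)%N (4 ^ j * G)%N _
    (fun k => if (k < size ms)%N then \sum_(l < d) \sum_(l' < d') c l l' * g l l' k else 0)) => //.
  - rewrite natrX -exprMn -xyw cE.
    under [RHS]eq_bigr => k _.
      rewrite ltn_ord rmorph_sum/= mulr_suml.
      over.
    rewrite [RHS]exchange_big/=; apply: eq_bigr => l _.
    under [RHS]eq_bigr => k _ do rewrite rmorph_sum/= mulr_suml.
    rewrite [RHS]exchange_big/=; apply: eq_bigr => l' _.
    rewrite gE mulr_sumr; apply: eq_bigr => k _.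
    by rewrite intrM mulrA.
  - move=> k; case: ifPn => [kms|_]; last by rewrite normr0.
    apply: le_trans (ler_norm_sum _ _ _) _.
    rewrite PoszM -[X in _ * X]intz sumMz mulr_sumr; apply: ler_sum => l _.
    apply: le_trans (ler_norm_sum _ _ _) _.
    rewrite sumMz mulr_sumr; apply: ler_sum => l' _.
    rewrite intz normrM; apply: ler_pM => //.
      by apply: le_trans (cb _ _) _; rewrite -[Posz _]natz natrX.
    by rewrite -abszE lez_nat (bigD1 (Ordinal kms))//= leq_addr.
  - by rewrite -mulnA.
move=> /eqP; rewrite expf_eq0 => /andP[_ /eqP w0].
by apply/eqP; rewrite -subr_eq0 xyw w0 mulr0.
Qed.

(** A form of Northcott's theorem.  The height-one roots of the group generate a ring
that is a finitely generated module, and the coordinates modulo [m] determine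
them: for [m = 5] by [height1_root_congr_eq] when no positive integer vanishes in
[K], and otherwise for any [m] that vanishes in [K]. *)
Theorem finite_height1_root s : (forall c, c \in s -> c != 0) ->
  finite_set [set x | gen (fun y => y \in s) x /\ height1_root x].
Proof.
move=> s0; set E : K -> Prop := fun x => _ /\ _.
have [x []//|bs bsE Ebs] := @gen_finite_basis s E s0.
have [|ms msg gms] := @gen_height1_zspan bs.
  by move=> b /bsE[gb hb]; split => //; apply: gen_neq0 gb.
have [g1 gM gV] := gen_subgroup (fun y => y \in bs).
have msM m m' : m \in ms -> m' \in ms -> zspan ms (m * m').
  by move=> /msg gm /msg gm'; apply/gms/gM.
(* congruence modulo m detects equality *)
have [m [m0 Hm]] : exists m : nat, (0 < m)%N /\ forall x y w, E x -> E y -> zspan ms w ->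
    x - y = m%:R * w -> x = y.
  have [[n [n0 nK]]|K0] := pselect (exists n, (0 < n)%N /\ n%:R = 0 :> K).
    exists n; split => // x y w _ _ _; rewrite nK mul0r => /eqP.
    by rewrite subr_eq0 => /eqP.
  exists 5%N; split => // x y w Ex Ey msw xyw.
  apply: (@height1_root_congr_eq _ ms x y w) => //.
  - by move=> n n0; apply/eqP => nK; apply: K0; exists n.
  - exact/gms.
  - move=> l l'; apply: gms; rewrite !exprnP; apply: gM.
      by apply: mul_subgroupX; [exact: gen_subgroup | exact: Ebs].
    by apply: mul_subgroupX; [exact: gen_subgroup | exact: Ebs].
  - by case: Ex.
  - by case: Ey.
have [c cE] : exists c : K -> nat -> int,
    forall x, E x -> x = \sum_(i < size ms) (c x i)%:~R * ms`_i.
  exists (fun x => if pselect (zspan ms x) is left h then projT1 (cid h) else fun=> 0).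
  move=> x Ex; case: pselect => [h|/(_ (gms x (Ebs x Ex)))//].
  exact: projT2 (cid h).
pose res x : {ffun 'I_(size ms) -> 'I_m} :=
  [ffun i => Ordinal (ltn_pmod `|(c x (val i) %% m)%Z|%N m0)].
pose r x := if `[< E x >] then Some (res x) else None.
have -> : [set x | E x] = r @^-1` [set o | isSome o].
  by apply/seteqP; split => x /=; rewrite /r; case: asboolP.
apply: finite_preimage; last exact: finite_finset.
move=> x y /set_mem/=; rewrite /r; case: asboolP => // Ex _ /set_mem/=.
case: asboolP => // Ey _ [/ffunP rxy].
have mZ : m%:Z != 0 by rewrite eqz_nat -lt0n.
have xyE i : (i < size ms)%N -> (c x i = c y i %[mod m])%Z.
  move=> im; have := congr1 val (rxy (Ordinal im)); rewrite !ffunE/= => e.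
  have bnd n : (`|(n %% m)%Z| < m)%N by rewrite -ltz_nat gez0_abs ?modz_ge0// ltz_pmod.
  by move: e; rewrite !modn_small// => /(congr1 Posz); rewrite !gez0_abs ?modz_ge0.
apply: (Hm x y (\sum_(i < size ms) ((c x i - c y i) %/ m)%Z%:~R * ms`_i)) => //.
  by exists (fun i => ((c x i - c y i) %/ m)%Z).
rewrite {1}(cE x Ex) {1}(cE y Ey) -sumrB mulr_sumr; apply: eq_bigr => i _.
rewrite -mulrBl -intrB mulrA; congr (_ * _).
rewrite -[m%:R]/(m%:Z%:~R) -intrM; congr (_%:~R).
by rewrite mulrC divzK// -eqz_mod_dvd; apply/eqP/xyE.
Qed.


(** Used to choose an exponent that avoids height-one roots. *)
Lemma gen_height1_escape s (f : nat -> K) : (forall c, c \in s -> c != 0) ->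
  (forall n, gen (fun y => y \in s) (f n)) -> injective f ->
  exists n, ~ height1_root (f n).
Proof.
move=> s0 fs finj; apply: contrapT => H.
apply: infinite_nat; apply: sub_finite_set (finite_preimage _ (finite_height1_root s0)); last first.
  by move=> a b _ _; apply: finj.
by move=> n _; split => //; apply: contrapT => nh; apply: H; exists n.
Qed.

Lemma unity_root_height1 z n : (0 < n)%N -> z ^+ n = 1 -> height1_root z.
Proof.
move=> n0 zn; exists ('X^n - 1); split.
- by rewrite -size_poly_eq0 size_XnsubC.
- move=> i; rewrite coefB coefXn coef1; case: eqP => [->|_]; last first.
    by case: eqP => _; rewrite ?subr0 ?sub0r ?normrN ?normr1 ?normr0.
  by rewrite (gtn_eqF n0) subr0 normr1.
by rewrite rmorphB/= map_polyXn rmorph1 hornerD hornerXn hornerN hornerC zn subrr.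
Qed.

(** * Freeness of two affine maps with the same linear part *)

Lemma expr_inj (a : K) : a != 0 -> (forall n, (0 < n)%N -> a ^+ n != 1) ->
  injective (fun n => a ^+ n).
Proof.
move=> a0 an k l /=; wlog kl : k l / (k <= l)%N => [H e|e].
  by case: (leqP k l) => [|/ltnW] h; [apply: H | symmetry; apply: H].
apply/eqP; rewrite eqn_leq kl leqNgt; apply/negP => lt.
have := an (l - k)%N; rewrite subn_gt0 lt => /(_ isT)/eqP; apply.
by apply: (mulIf (expf_neq0 k a0)); rewrite -exprD subnK ?mul1r// ltnW.
Qed.

Lemma word_lin (g h : aff K) w : aff_lin h = aff_lin g ->
  aff_lin (word g h w) = aff_lin g ^+ size w.
Proof.
move=> gh; rewrite /word; elim: w => [|b w IH]; first by rewrite big_nil.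
by rewrite big_cons exprS -IH; case: b; rewrite /aff_lin/= -?/(aff_lin h) ?gh.
Qed.

Lemma word_trans (g h : aff K) w : aff_lin h = aff_lin g ->
  aff_trans (word g h w) = \sum_(i < size w) aff_lin g ^+ i *
    (if nth true w i then aff_trans g else aff_trans h).
Proof.
move=> gh; rewrite /word; elim: w => [|b w IH]; first by rewrite big_nil big_ord0.
rewrite big_cons /= big_ord_recl expr0 mul1r addrC.
under [X in _ = X + _]eq_bigr => i _ do rewrite lift0 exprS -mulrA /=.
rewrite -mulr_sumr -IH.
by case: b; rewrite /aff_lin /aff_trans/= -?/(aff_lin h) ?gh.
Qed.

(** Equal words have equal length because the linear part has infinite order.  Then
the difference of their translation parts is the difference of the two
translations times the value at the linear part of the polynomial whose
coefficients compare the letters. *)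
Lemma free_semigroup_aff (g h : aff K) : aff_lin h = aff_lin g ->
  ~ height1_root (aff_lin g) -> aff_trans g <> aff_trans h -> free_semigroup g h.
Proof.
move=> gh nh1 tgh u v _ _ uv e.
have lE := congr1 (@aff_lin K) e; rewrite !word_lin// in lE.
have g0 := aff_lin_neq0 g.
have suv : size u = size v.
  wlog lt : u v uv e lE / (size u < size v)%N => [W|].
    case: (ltngtP (size u) (size v)) => // [/W|/W]; first exact.
    by move=> -> //; rewrite eq_sym.
  case: nh1; apply: (@unity_root_height1 _ (size v - size u)%N); first by rewrite subn_gt0.
  apply: (mulIf (expf_neq0 (size u) g0)).
  by rewrite -exprD subnK ?mul1r// ltnW.
have tE := congr1 (@aff_trans K) e; rewrite !word_trans// in tE.
pose p : {poly int} := \poly_(i < size v) ((nth true u i)%:R - (nth true v i)%:R).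
apply: nh1; exists p; split.
- apply: contra_neq uv => p0; apply: (@eq_from_nth _ true) => // i.
  rewrite suv => iv; have := congr1 (fun q : {poly int} => q`_i) p0.
  by rewrite coef_poly iv coef0; case: (nth _ u i); case: (nth _ v i).
- move=> i; rewrite coef_poly; case: ifP => [_|]; last by rewrite normr0.
  by case: (nth _ u i); case: (nth _ v i).
have tgh0 : aff_trans g - aff_trans h != 0 by rewrite subr_eq0; apply/eqP.
apply: (mulIf tgh0); rewrite mul0r (horner_map_intr _ (size_poly _ _)) mulr_suml.
move/eqP: tE; rewrite suv -subr_eq0 -sumrB => /eqP {}tE; rewrite -[RHS]tE.
apply: eq_bigr => i _; rewrite coef_poly ltn_ord -mulrBr mulrAC [RHS]mulrC; congr (_ * _).
by case: (nth _ u i); case: (nth _ v i); rewrite /= ?subrr ?mul0r ?subr0 ?mul1r// sub0r mulN1r opprB.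
Qed.

Lemma not_free_semigroup_lin1 (g h : aff K) : aff_lin g = 1 -> aff_lin h = 1 ->
  ~ free_semigroup g h.
Proof.
move=> g1 h1 /(_ [:: true; false] [:: false; true] erefl erefl erefl); apply.
rewrite /word !big_cons !big_nil !mulg1; apply: aff_eq.
  by rewrite /aff_lin/= -!/(aff_lin _) g1 h1.
by rewrite /aff_trans/= g1 h1 !mul1r addrC.
Qed.

End Algebra.
(** * The Nash inequality on a group *)

Section FiniteSupport.
Context (G : choiceType) (R : realType).
Implicit Types f h : G -> R.

Definition fin_supp f := finite_set [set x | f x != 0].
Definition tot f : R := \sum_(x \in [set: G]) f x.

Lemma fin_supp_le2 f1 f2 f : fin_supp f1 -> fin_supp f2 ->
  (forall x, f1 x = 0 -> f2 x = 0 -> f x = 0) -> fin_supp f.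
Proof.
move=> s1 s2 H; apply: (@sub_finite_set _ _ ([set x | f1 x != 0] `|` [set x | f2 x != 0])).
  move=> x /=; case: (eqVneq (f1 x) 0) => [f10|]; last by left.
  case: (eqVneq (f2 x) 0) => [f20|]; last by right.
  by rewrite H// eqxx.
by rewrite finite_setU.
Qed.

Lemma fin_supp_le f1 f : fin_supp f1 -> (forall x, f1 x = 0 -> f x = 0) -> fin_supp f.
Proof. by move=> s1 H; apply: (fin_supp_le2 s1 s1) => x /H. Qed.

Lemma fin_supp_seq f (r : seq G) : (forall x, f x != 0 -> x \in r) -> fin_supp f.
Proof. by move=> H; apply: sub_finite_set (finite_seq r) => x /H. Qed.

Lemma tot_seq f (r : seq G) : uniq r -> (forall x, f x != 0 -> x \in r) ->
  tot f = \sum_(x <- r) f x.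
Proof.
move=> ur H; rewrite /tot (@fsbigE _ _ _ _ _ r)//.
  by apply: eq_bigl => x; rewrite in_setT.
by move=> x _ xr; apply/eqP; apply: contraNT xr; apply: H.
Qed.

Lemma fin_suppP f : fin_supp f -> exists r : seq G, forall x, f x != 0 -> x \in r.
Proof.
by move=> /finite_seqP[r fr]; exists r => x fx; have : [set x | f x != 0] x by []; rewrite fr.
Qed.

Lemma fin_supp_seq2 f h : fin_supp f -> fin_supp h ->
  exists r : seq G, [/\ uniq r, forall x, f x != 0 -> x \in r &
    forall x, h x != 0 -> x \in r].
Proof.
move=> /fin_suppP[r fr] /fin_suppP[s hs]; exists (undup (r ++ s)); split.
- exact: undup_uniq.
- by move=> x /fr xr; rewrite mem_undup mem_cat xr.
- by move=> x /hs xs; rewrite mem_undup mem_cat xs orbT.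
Qed.

Lemma totD f h : fin_supp f -> fin_supp h ->
  tot (fun x => f x + h x) = tot f + tot h.
Proof.
move=> sf sh; have [r [ur fr hr]] := fin_supp_seq2 sf sh.
rewrite !(@tot_seq _ r)// ?big_split// => x.
case: (eqVneq (f x) 0) => [->|/fr//]; rewrite add0r; exact: hr.
Qed.

Lemma totZ (a : R) f : tot (fun x => a * f x) = a * tot f.
Proof. by rewrite /tot mulr_fsumr. Qed.

Lemma eq_tot f h : f =1 h -> tot f = tot h.
Proof. by move=> /funext ->. Qed.

Lemma fin_supp0 : fin_supp (fun=> 0 : R).
Proof. by apply: (@fin_supp_seq _ [::]) => x; rewrite eqxx. Qed.

Lemma tot0 : tot (fun=> 0 : R) = 0.
Proof. by rewrite (@tot_seq _ [::]) ?big_nil// => x; rewrite eqxx. Qed.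

Lemma fin_suppD f h : fin_supp f -> fin_supp h -> fin_supp (fun x => f x + h x).
Proof. by move=> sf sh; apply: (fin_supp_le2 sf sh) => x -> ->; rewrite addr0. Qed.

Lemma fin_suppZ (a : R) f : fin_supp f -> fin_supp (fun x => a * f x).
Proof. by move=> sf; apply: (fin_supp_le sf) => x ->; rewrite mulr0. Qed.

Lemma fin_supp_sum (J : Type) (r : seq J) (F : J -> G -> R) :
  (forall j, fin_supp (F j)) -> fin_supp (fun x => \sum_(j <- r) F j x).
Proof.
move=> sF; elim: r => [|j r IH].
  by apply: (fin_supp_le fin_supp0) => x _; rewrite big_nil.
by apply: (fin_supp_le2 (sF j) IH) => x; rewrite big_cons => -> ->; rewrite addr0.
Qed.

Lemma tot_sum (J : Type) (r : seq J) (F : J -> G -> R) :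
  (forall j, fin_supp (F j)) ->
  tot (fun x => \sum_(j <- r) F j x) = \sum_(j <- r) tot (F j).
Proof.
move=> sF; elim: r => [|j r IH].
  by rewrite big_nil -[RHS]tot0; apply: eq_tot => x; rewrite big_nil.
rewrite big_cons -IH -totD//; last exact: fin_supp_sum.
by apply: eq_tot => x; rewrite big_cons.
Qed.

Lemma tot_ge0 f : (forall x, 0 <= f x) -> 0 <= tot f.
Proof. by move=> f0; apply: fsumr_ge0. Qed.

Lemma le_tot f h : fin_supp f -> fin_supp h -> (forall x, f x <= h x) ->
  tot f <= tot h.
Proof.
move=> sf sh fh; have [r [ur fr hr]] := fin_supp_seq2 sf sh.
by rewrite !(@tot_seq _ r)//; apply: ler_sum.
Qed.

Lemma sum_uniq_le_tot f (s : seq G) : fin_supp f -> (forall x, 0 <= f x) ->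
  uniq s -> \sum_(x <- s) f x <= tot f.
Proof.
move=> sf f0 us; have [r fr] := fin_suppP sf.
rewrite (@tot_seq _ (s ++ [seq x <- undup r | x \notin s])).
- by rewrite big_cat/= lerDl sumr_ge0.
- rewrite cat_uniq us filter_uniq ?undup_uniq// andbT.
  by apply/hasPn => x; rewrite mem_filter => /andP[].
- by move=> x /fr xr; rewrite mem_cat mem_filter mem_undup xr andbT orbN.
Qed.

Lemma le_tot_pt f x : fin_supp f -> (forall x, 0 <= f x) -> f x <= tot f.
Proof.
by move=> sf f0; have := @sum_uniq_le_tot f [:: x] sf f0 isT; rewrite big_seq1.
Qed.

Lemma tot_bij (p : G -> G) f : bijective p -> tot (fun x => f (p x)) = tot f.
Proof. by move=> bp; rewrite /tot -(@reindex_fsbigT _ _ _ _ _ _ f bp). Qed.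

End FiniteSupport.

Section Translations.
Context (G : groupType) (R : realType).
Implicit Types (f h : G -> R) (g : G).

Definition ltrans g f : G -> R := fun x => f (g^-1 * x)%g.
Definition sqnorm f := tot (fun x => f x ^+ 2).
Definition displacement g f := sqnorm (fun x => f x - ltrans g f x).

Lemma lmul_bij g : bijective (fun x : G => g * x)%g.
Proof. by exists (fun x => g^-1 * x)%g => x; rewrite (mulKg, mulVKg). Qed.

Lemma fin_supp_ltrans g f : fin_supp f -> fin_supp (ltrans g f).
Proof.
move=> /fin_suppP[r fr]; apply: (@fin_supp_seq _ _ _ [seq (g * y)%g | y <- r]) => x /fr xr.
by apply/mapP; exists (g^-1 * x)%g; rewrite ?mulVKg.
Qed.

Lemma tot_ltrans g f : tot (ltrans g f) = tot f.
Proof. exact: (tot_bij f (lmul_bij _)). Qed.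

Lemma sqnorm_ltrans g f : sqnorm (ltrans g f) = sqnorm f.
Proof. exact: (tot_ltrans g (fun x => f x ^+ 2)). Qed.

Lemma sqnorm_ge0 f : 0 <= sqnorm f.
Proof. by apply: tot_ge0 => x; rewrite sqr_ge0. Qed.

Lemma fin_supp_sqr f : fin_supp f -> fin_supp (fun x => f x ^+ 2).
Proof. by move=> sf; apply: (fin_supp_le sf) => x ->; rewrite expr0n. Qed.

Lemma fin_suppM f h : fin_supp f -> fin_supp (fun x => f x * h x).
Proof. by move=> sf; apply: (fin_supp_le sf) => x ->; rewrite mul0r. Qed.

Lemma fin_supp_disp g f : fin_supp f -> fin_supp (fun x => f x - ltrans g f x).
Proof.
move=> sf; apply: (fin_supp_le2 sf (fin_supp_ltrans g sf)) => x -> ->.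
by rewrite subrr.
Qed.

(** Translation preserves the norm, so polarization has no other term. *)
Lemma tot_mul_ltrans g f : fin_supp f ->
  tot (fun x => f x * ltrans g f x) = sqnorm f - displacement g f / 2.
Proof.
move=> sf; have sg := fin_supp_ltrans g sf.
have -> : displacement g f = sqnorm f + sqnorm (ltrans g f) -
    2 * tot (fun x => f x * ltrans g f x).
  have sA := fin_supp_sqr sf; have sB := fin_supp_sqr sg.
  rewrite /displacement /sqnorm -mulNr -totZ -totD// -totD//; last first.
  - exact/fin_suppZ/fin_suppM.
  - exact: fin_suppD.
  by apply: eq_tot => x; ring.
by rewrite sqnorm_ltrans; field.
Qed.

(** Compare [f] with the average of its translates by [s].  That average is at most
[1 / size s] everywhere, because the points [g^-1 x] are distinct; and replacing
[f] by a translate in the inner product with [f] costs half of the displacement. *)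
Lemma nash f (s : seq G) (E : R) : fin_supp f -> (forall x, 0 <= f x) -> tot f = 1 ->
  uniq s -> (0 < size s)%N -> (forall g, g \in s -> displacement g f <= E) ->
  sqnorm f <= (size s)%:R^-1 + E / 2.
Proof.
move=> sf f0 f1 us s0 sE.
have L0 : 0 < (size s)%:R :> R by rewrite ltr0n.
rewrite -(ler_pM2l L0) mulrDr mulfV ?gt_eqF//.
have <- : \sum_(g <- s) sqnorm f = (size s)%:R * sqnorm f.
  by rewrite big_const_seq count_predT iter_addr_0 mulr_natl.
have -> : (size s)%:R * (E / 2) = \sum_(g <- s) E / 2.
  by rewrite -mulr_suml big_const_seq count_predT iter_addr_0 mulrA mulr_natl.
rewrite -lerBlDr -sumrB; apply: (@le_trans _ _
    (\sum_(g <- s) tot (fun x => f x * ltrans g f x))).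
  rewrite [leLHS]big_seq [leRHS]big_seq; apply: ler_sum => g /sE gE.
  by rewrite tot_mul_ltrans// lerD2l lerN2 ler_pM2r.
rewrite -tot_sum; last by move=> g; apply: fin_suppM.
rewrite -f1; apply: le_tot => //.
  by apply: fin_supp_sum => g; apply: fin_suppM.
move=> x; rewrite -mulr_sumr ler_piMr// -f1.
have -> : \sum_(g <- s) ltrans g f x = \sum_(y <- [seq (g^-1 * x)%g | g <- s]) f y.
  by rewrite big_map.
apply: sum_uniq_le_tot => //; rewrite map_inj_uniq// => a b /mulIg.
exact: invg_inj.
Qed.

(** The square root of the displacement is subadditive.  On squares this is the
inequality [(u + v)^2 <= (1 + 1/r) u^2 + (1 + r) v^2]. *)
Lemma displacementM (g h : G) f (C : R) (r : nat) : fin_supp f -> (0 < r)%N ->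
  displacement g f <= r%:R ^+ 2 * C -> displacement h f <= C ->
  displacement (g * h)%g f <= r.+1%:R ^+ 2 * C.
Proof.
move=> sf r0 gC hC.
have rp : 0 < r%:R :> R by rewrite ltr0n.
pose u x := f x - ltrans g f x; pose v x := f x - ltrans h f x.
have su : fin_supp u by exact: fin_supp_disp.
have sv : fin_supp v by exact: fin_supp_disp.
have E x : f x - ltrans (g * h)%g f x = u x + ltrans g v x.
  by rewrite /u /v /ltrans invgM mulgA; ring.
rewrite -(ler_pM2l rp) /displacement.
have -> : sqnorm (fun x => f x - ltrans (g * h)%g f x) = tot (fun x => (u x + ltrans g v x) ^+ 2).
  by apply: eq_tot => x; rewrite E.
rewrite -totZ.
apply: (@le_trans _ _ (tot (fun x => (r%:R + 1) * u x ^+ 2 +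
    r%:R * (r%:R + 1) * ltrans g v x ^+ 2))).
  apply: le_tot.
  - by apply/fin_suppZ/fin_supp_sqr/fin_suppD => //; exact: fin_supp_ltrans.
  - apply: fin_suppD; first exact/fin_suppZ/fin_supp_sqr.
    exact/fin_suppZ/fin_supp_sqr/fin_supp_ltrans.
  - move=> x; rewrite -subr_ge0.
    have -> : (r%:R + 1) * u x ^+ 2 + r%:R * (r%:R + 1) * ltrans g v x ^+ 2 -
      r%:R * (u x + ltrans g v x) ^+ 2 = (u x - r%:R * ltrans g v x) ^+ 2 by ring.
    exact: sqr_ge0.
rewrite totD; first last.
- exact/fin_suppZ/fin_supp_sqr/fin_supp_ltrans.
- exact/fin_suppZ/fin_supp_sqr.
rewrite !totZ -![tot (fun x => _ ^+ 2)]/(sqnorm _) sqnorm_ltrans.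
have -> : r%:R * (r.+1%:R ^+ 2 * C) =
  (r%:R + 1) * (r%:R ^+ 2 * C) + r%:R * (r%:R + 1) * C :> R by rewrite -natr1; ring.
by apply: lerD; apply: ler_wpM2l => //; rewrite ?mulr_ge0 ?addr_ge0.
Qed.

End Translations.

(** * Markov operators and their energy *)

Section MarkovOperators.
Context (G : groupType) (R : realType) (I : finType) (mu : I -> R) (gs : I -> G).
Hypothesis mu0 : forall i, 0 <= mu i.
Hypothesis mu1 : \sum_i mu i = 1.
Implicit Types (f h phi : G -> R).

Definition step_law f : G -> R := fun x => \sum_i mu i * ltrans (gs i) f x.
Definition step_mean phi : G -> R := fun x => \sum_i mu i * phi (gs i * x)%g.
(** Staying put with probability 1/2 makes the energy control the loss of l2 norm in
one step, as in [sqnorm_lazy].  Without it, the loss only involves displacements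
by the quotients [g^-1 h] of two steps, and these may all commute. *)
Definition lazy (Op : (G -> R) -> G -> R) f : G -> R := fun x => (f x + Op f x) / 2.
Definition energy f := \sum_i mu i * displacement (gs i) f.
Definition dirac1 : G -> R := fun x => (x == 1%g)%:R.
Definition wprod (w : seq I) : G := (\prod_(i <- w) gs i)%g.

Lemma fin_supp_step f : fin_supp f -> fin_supp (step_law f).
Proof.
by move=> sf; apply: fin_supp_sum => i; apply/fin_suppZ/fin_supp_ltrans.
Qed.

Lemma fin_supp_lazy f : fin_supp f -> fin_supp (lazy step_law f).
Proof.
move=> sf; apply: (fin_supp_le2 sf (fin_supp_step sf)) => x fx; rewrite /lazy fx => ->.
by rewrite addr0 mul0r.
Qed.

Lemma step_ge0 f : (forall x, 0 <= f x) -> forall x, 0 <= step_law f x.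
Proof. by move=> f0 x; apply: sumr_ge0 => i _; apply: mulr_ge0; [exact: mu0 | exact: f0]. Qed.

Lemma tot_step f : fin_supp f -> tot (step_law f) = tot f.
Proof.
move=> sf; rewrite tot_sum; last by move=> i; apply/fin_suppZ/fin_supp_ltrans.
under eq_bigr => i _ do rewrite totZ tot_ltrans.
by rewrite -mulr_suml mu1 mul1r.
Qed.

Lemma tot_lazy f : fin_supp f -> tot (lazy step_law f) = tot f.
Proof.
move=> sf; rewrite [LHS](_ : _ = tot (fun x => 2^-1 * (f x + step_law f x))); last first.
  by apply: eq_tot => x; rewrite mulrC.
have ss := fin_supp_step sf; rewrite totZ totD// tot_step//; lra.
Qed.

(** The two operators are adjoint: one transports laws, the other test functions. *)
Lemma tot_step_mul f phi : fin_supp f ->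
  tot (fun x => step_law f x * phi x) = tot (fun x => f x * step_mean phi x).
Proof.
move=> sf.
have s1 i : fin_supp (fun x => mu i * (ltrans (gs i) f x * phi x)).
  exact/fin_suppZ/fin_suppM/fin_supp_ltrans.
have s2 i : fin_supp (fun x => mu i * (f x * phi (gs i * x)%g)).
  exact/fin_suppZ/fin_suppM.
transitivity (tot (fun x => \sum_i mu i * (ltrans (gs i) f x * phi x))).
  by apply: eq_tot => x; rewrite mulr_suml; apply: eq_bigr => i _; rewrite mulrA.
transitivity (tot (fun x => \sum_i mu i * (f x * phi (gs i * x)%g))); last first.
  by apply: eq_tot => x; rewrite mulr_sumr; apply: eq_bigr => i _; rewrite mulrCA.
rewrite !tot_sum//; apply: eq_bigr => i _; rewrite !totZ; congr (_ * _).
rewrite -(tot_ltrans (gs i) (fun x => f x * phi (gs i * x)%g)); apply: eq_tot => x.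
by rewrite /ltrans mulVKg.
Qed.

Lemma jensen_sqr (a : I -> R) : (\sum_i mu i * a i) ^+ 2 <= \sum_i mu i * a i ^+ 2.
Proof.
set b := \sum_i mu i * a i; rewrite -subr_ge0.
have <- : \sum_i mu i * (a i - b) ^+ 2 = \sum_i mu i * a i ^+ 2 - b ^+ 2.
  transitivity (\sum_i (mu i * a i ^+ 2 - 2 * b * (mu i * a i) + b ^+ 2 * mu i)).
    by apply: eq_bigr => i _; ring.
  by rewrite big_split sumrB/= -!mulr_sumr mu1 -/b; ring.
by apply: sumr_ge0 => i _; rewrite mulr_ge0 ?sqr_ge0.
Qed.

Lemma sqnorm_step f : fin_supp f -> sqnorm (step_law f) <= sqnorm f.
Proof.
move=> sf; have s2 i : fin_supp (fun x => mu i * ltrans (gs i) f x ^+ 2).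
  exact/fin_suppZ/fin_supp_sqr/fin_supp_ltrans.
apply: (@le_trans _ _ (tot (fun x => \sum_i mu i * ltrans (gs i) f x ^+ 2))).
  apply: le_tot; [exact/fin_supp_sqr/fin_supp_step | exact: fin_supp_sum|].
  by move=> x; apply: jensen_sqr.
rewrite tot_sum//.
under eq_bigr => i _ do rewrite totZ -[tot _]/(sqnorm (ltrans _ _)) sqnorm_ltrans.
by rewrite -mulr_suml mu1 mul1r.
Qed.

Lemma tot_mul_step f : fin_supp f ->
  tot (fun x => f x * step_law f x) = sqnorm f - energy f / 2.
Proof.
move=> sf; transitivity (tot (fun x => \sum_i mu i * (f x * ltrans (gs i) f x))).
  by apply: eq_tot => x; rewrite mulr_sumr; apply: eq_bigr => i _; rewrite mulrCA.
rewrite tot_sum; last by move=> i; apply/fin_suppZ/fin_suppM.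
under eq_bigr => i _ do rewrite totZ tot_mul_ltrans// mulrBr mulrA.
by rewrite sumrB -mulr_suml mu1 mul1r -mulr_suml.
Qed.

(** Expand the square: the step contracts the norm by convexity, and the cross term
is the norm minus half of the energy. *)
Lemma sqnorm_lazy f : fin_supp f ->
  sqnorm (lazy step_law f) <= sqnorm f - energy f / 4.
Proof.
move=> sf; have ss := fin_supp_step sf.
have sA := fin_supp_sqr sf; have sB := fin_supp_sqr ss.
have sC : fin_supp (fun x => 2 * (f x * step_law f x)) by exact/fin_suppZ/fin_suppM.
have -> : sqnorm (lazy step_law f) = 4^-1 *
    (sqnorm f + sqnorm (step_law f) + 2 * tot (fun x => f x * step_law f x)).
  rewrite /sqnorm -totZ -totD// -totD//; last exact: fin_suppD.
  by rewrite -totZ; apply: eq_tot => x; rewrite /lazy; field.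
rewrite tot_mul_step//; have := sqnorm_step sf; lra.
Qed.

Lemma energy_ge0 f : 0 <= energy f.
Proof. by apply: sumr_ge0 => i _; rewrite mulr_ge0// sqnorm_ge0. Qed.

Lemma displacement_le_energy (m : R) f i : 0 < m -> m <= mu i ->
  displacement (gs i) f <= energy f / m.
Proof.
move=> m0 mi; rewrite ler_pdivlMr// mulrC.
apply: (@le_trans _ _ (mu i * displacement (gs i) f)).
  by apply: ler_wpM2r => //; apply: sqnorm_ge0.
rewrite /energy (bigD1 i)//= lerDl sumr_ge0// => j _.
by rewrite mulr_ge0// sqnorm_ge0.
Qed.

Lemma displacement1 f : displacement 1%g f = 0.
Proof.
rewrite -(@tot0 G R); apply: eq_tot => x.
by rewrite /ltrans invg1 mul1g subrr expr0n.
Qed.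

Lemma displacement_wprod f (C : R) w : fin_supp f -> 0 <= C ->
  (forall i, displacement (gs i) f <= C) ->
  displacement (wprod w) f <= (size w)%:R ^+ 2 * C.
Proof.
move=> sf C0 HC; elim/last_ind: w => [|w i IH].
  by rewrite /wprod big_nil displacement1 mulr_ge0 ?sqr_ge0.
rewrite /wprod big_rcons/= -/(wprod w) size_rcons.
case: w IH => [_|j w IH]; first by rewrite /wprod big_nil mul1g expr1n mul1r.
exact: displacementM.
Qed.

Lemma fin_supp_dirac : fin_supp dirac1.
Proof.
apply: (@fin_supp_seq _ _ _ [:: 1%g]) => x; rewrite /dirac1 inE.
by case: (x == 1%g); rewrite ?eqxx.
Qed.

Lemma tot_dirac_mul phi : tot (fun x => dirac1 x * phi x) = phi 1%g.
Proof.
rewrite (@tot_seq _ _ _ [:: 1%g])// ?big_seq1 /dirac1 ?eqxx ?mul1r//.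
by move=> x; rewrite inE; case: (x == 1%g); rewrite // mul0r eqxx.
Qed.

Lemma tot_dirac : tot dirac1 = 1.
Proof. by rewrite -[RHS](tot_dirac_mul (fun=> 1)); apply: eq_tot => x; rewrite mulr1. Qed.

Section Iterates.
Let law n := iter n step_law dirac1.
Let lazy_law n := iter n (lazy step_law) dirac1.

Lemma law_props n :
  [/\ fin_supp (law n), forall x, 0 <= law n x & tot (law n) = 1].
Proof.
elim: n => [|n [IH1 IH2 IH3]].
  by split; [exact: fin_supp_dirac | by move=> x; rewrite ler0n | exact: tot_dirac].
split; [exact: fin_supp_step | exact: step_ge0 | by rewrite /law/= tot_step].
Qed.

Lemma lazy_law_props n :
  [/\ fin_supp (lazy_law n), forall x, 0 <= lazy_law n x & tot (lazy_law n) = 1].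
Proof.
elim: n => [|n [IH1 IH2 IH3]].
  by split; [exact: fin_supp_dirac | by move=> x; rewrite ler0n | exact: tot_dirac].
split; [exact: fin_supp_lazy | | by rewrite /lazy_law/= tot_lazy].
by move=> x; rewrite divr_ge0// addr_ge0//; apply: step_ge0.
Qed.

Lemma tot_law_mul n phi : tot (fun x => law n x * phi x) = iter n step_mean phi 1%g.
Proof.
elim: n phi => [|n IH] phi; first exact: tot_dirac_mul.
rewrite iterSr -IH; apply: tot_step_mul; by have [] := law_props n.
Qed.

Lemma tot_lazy_law_mul n phi :
  tot (fun x => lazy_law n x * phi x) = iter n (lazy step_mean) phi 1%g.
Proof.
elim: n phi => [|n IH] phi; first exact: tot_dirac_mul.
have [sf _ _] := lazy_law_props n.
rewrite iterSr -IH /lazy_law/= -/(lazy_law n).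
have s1 : fin_supp (fun x => lazy_law n x * phi x) by exact: fin_suppM.
have s2 : fin_supp (fun x => step_law (lazy_law n) x * phi x).
  exact/fin_suppM/fin_supp_step.
have s3 : fin_supp (fun x => lazy_law n x * step_mean phi x) by exact: fin_suppM.
transitivity (2^-1 * (tot (fun x => lazy_law n x * phi x) +
    tot (fun x => step_law (lazy_law n) x * phi x))).
  by rewrite -totD// -totZ; apply: eq_tot => x; rewrite /lazy; ring.
rewrite tot_step_mul// -totD// -totZ; apply: eq_tot => x; rewrite /lazy; ring.
Qed.

End Iterates.

End MarkovOperators.

(** * Decay of the laws of a random walk *)

Section RealSequences.
Context (R : realType).

Lemma sum_shift (u : nat -> R) N :
  \sum_(n < N) u n - \sum_(n < N) u n.+1 = u 0%N - u N.
Proof.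
elim: N => [|N IH]; first by rewrite !big_ord0 !subrr.
by rewrite !big_ord_recr/= opprD addrACA IH; ring.
Qed.

Lemma bernoulli_le (x : R) n : 0 <= x -> 1 + n%:R * x <= (1 + x) ^+ n.
Proof.
move=> x0; elim: n => [|n IH]; first by rewrite mul0r addr0 expr0.
have nx : 0 <= n%:R * x ^+ 2 by rewrite mulr_ge0// sqr_ge0.
rewrite exprS; apply: le_trans (ler_wpM2l _ IH); last by rewrite addr_ge0.
rewrite -natr1; nra.
Qed.

Lemma bernoulli_inv_le (x : R) n : 0 <= x <= 1 -> (1 - x) ^+ n <= (1 + n%:R * x)^-1.
Proof.
move=> /andP[x0 x1].
have nx : 0 < 1 + n%:R * x by rewrite ltr_wpDr// mulr_ge0.
rewrite -[leRHS]mul1r ler_pdivlMr//; apply: le_trans (ler_wpM2l _ (bernoulli_le n x0)) _.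
  by rewrite exprn_ge0// subr_ge0.
by rewrite -exprMn exprn_ile1//; nra.
Qed.

Lemma polynomial_exp_bounded (rho : R) d : 0 < rho < 1 ->
  exists C : R, forall J : nat, J.+1%:R ^+ d * rho ^+ J <= C.
Proof.
elim: d rho => [|d IH] rho /andP[r0 r1].
  by exists 1 => J; rewrite mul1r exprn_ile1// ltW.
pose s := Num.sqrt rho.
have s0 : 0 < s by rewrite sqrtr_gt0.
have s1 : s < 1 by rewrite -sqrtr1 ltr_sqrt.
have [C HC] := IH s (introT andP (conj s0 s1)).
pose x := s^-1 - 1.
have x0 : 0 < x by rewrite subr_gt0 invf_gt1.
have C0 : 0 <= C by apply: le_trans (HC 0%N); rewrite expr1n mul1r.
exists ((1 + x^-1) * C) => J.
have -> : rho = s * s by rewrite -expr2 sqr_sqrtr// ltW.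
rewrite exprS exprMn mulrACA; apply: ler_pM (HC J) => //.
- by rewrite mulr_ge0// exprn_ge0// ltW.
- by rewrite mulr_ge0// exprn_ge0// ltW.
have sx : s * (1 + x) = 1 by rewrite /x addrC subrK mulfV// gt_eqF.
have h : (1 + J%:R * x) * s ^+ J <= 1.
  have := ler_wpM2r (exprn_ge0 J (ltW s0)) (bernoulli_le J (ltW x0)).
  by rewrite -exprMn (mulrC _ s) sx expr1n.
apply: (@le_trans _ _ ((1 + x^-1) * ((1 + J%:R * x) * s ^+ J))); last first.
  by rewrite ler_piMr// addr_ge0// invr_ge0 ltW.
rewrite mulrA; apply: ler_wpM2r; first by rewrite exprn_ge0// ltW.
have -> : (1 + x^-1) * (1 + J%:R * x) = J.+1%:R + (J%:R * x + x^-1).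
  by rewrite -natr1; field; rewrite gt_eqF.
by rewrite lerDl addr_ge0// ?mulr_ge0 ?invr_ge0// ltW.
Qed.

Lemma sum_inv_sqr_le N : \sum_(n < N) (n.+1%:R ^+ 2)^-1 <= 2 :> R.
Proof.
suff H : \sum_(n < N.+1) (n.+1%:R ^+ 2)^-1 <= 2 - N.+1%:R^-1 :> R.
  case: N H => [_|N H]; first by rewrite big_ord0.
  apply: le_trans (_ : _ <= \sum_(n < N.+2) (n.+1%:R ^+ 2)^-1) _.
    by rewrite [leRHS]big_ord_recr/= lerDl invr_ge0 exprn_ge0.
  by apply: le_trans H _; rewrite lerBlDr lerDl invr_ge0.
elim: N => [|N IH]; first by rewrite big_ord_recr big_ord0/=; lra.
rewrite big_ord_recr/=; apply: le_trans (lerD IH (lexx _)) _.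
set a : R := N.+1%:R; have a0 : 0 < a by rewrite ltr0n.
have -> : N.+2%:R = a + 1 :> R by rewrite natr1.
rewrite -subr_ge0.
have -> : 2 - (a + 1)^-1 - (2 - a^-1 + ((a + 1) ^+ 2)^-1) = (a * (a + 1) ^+ 2)^-1.
  by field; rewrite !gt_eqF// addr_gt0.
by rewrite invr_ge0 mulr_ge0 ?sqr_ge0 ?ltW.
Qed.

(** [A n j] stands for the expectation of the [j]-th term after [n] lazy steps.  For the
complete sums [s j] over [n], the recursion reads [s j = 2 A 0 j + s j.+1], so the
lazy series dominates twice the series of the [A 0 j].  For partial sums the
recursion has the defect [A n j], and [n] can be chosen to make it small. *)
Lemma lazy_series_le (A : nat -> nat -> R) (C : R) :
  (forall n j, 0 <= A n j) ->
  (forall n j, A n.+1 j = (A n j + A n j.+1) / 2) ->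
  (forall N, \sum_(n < N) A n 0%N <= C) ->
  forall J, \sum_(j < J) A 0%N j <= C.
Proof.
move=> A0 AS AC.
pose s N j := \sum_(n < N) A n j.
have sS N j : s N.+1 j = A 0%N j + s N j / 2 + s N j.+1 / 2.
  rewrite /s big_ord_recl -addrA -mulrDl -big_split mulr_suml/=; congr (_ + _).
  by apply: eq_bigr => i _; rewrite -AS.
have sr N j : s N.+1 j = s N j + A N j by rewrite /s big_ord_recr.
have claim j N : s N j + 2 * \sum_(i < j) A 0%N i <= C.
  elim: j N => [|j IH] N; first by rewrite big_ord0 mulr0 addr0; apply: AC.
  rewrite leNgt; apply/negP => H.
  pose B := C - 2 * \sum_(i < j.+1) A 0%N i.
  have HB : 0 < s N j.+1 - B by rewrite /B; lra.
  have mono k : s N j.+1 <= s (N + k)%N j.+1.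
    elim: k => [|k]; first by rewrite addn0.
    by move/le_trans; apply; rewrite addnS sr lerDl.
  have big k : s N j.+1 - B <= A (N + k)%N j.
    have := IH (N + k).+1; have := sS (N + k)%N j; have := sr (N + k)%N j.
    by have := mono k; rewrite /B big_ord_recr/=; lra.
  have lin k : k%:R * (s N j.+1 - B) <= s (N + k)%N j.
    elim: k => [|k IHk]; first by rewrite mul0r sumr_ge0.
    by rewrite addnS sr -natr1 mulrDl mul1r lerD.
  have C0 : 0 <= C.
    apply: le_trans (IH 0%N); rewrite addr_ge0 ?sumr_ge0// mulr_ge0// sumr_ge0//.
  have := archi_boundP (divr_ge0 C0 (ltW HB)); set k := Num.bound _.
  rewrite ltr_pdivrMr// => Ck; have := IH (N + k)%N.
  have : 0 <= \sum_(i < j) A 0%N i by rewrite sumr_ge0.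
  have := lin k; lra.
move=> J; have := claim J 0%N; rewrite /s big_ord0 add0r.
have : 0 <= \sum_(j < J) A 0%N j by rewrite sumr_ge0.
lra.
Qed.

End RealSequences.

Section HeatKernel.
Context (G : groupType) (R : realType) (I : finType) (mu : I -> R) (gs : I -> G).
Hypothesis mu1 : \sum_i mu i = 1.
Context (m : R).
Hypotheses (m0 : 0 < m) (mum : forall i, m <= mu i).

Let mu0 i : 0 <= mu i. Proof. by apply: le_trans (mum i); apply: ltW. Qed.
Let law n := iter n (step_law mu gs) (dirac1 R : G -> R).
Let lazy_law n := iter n (lazy (step_law mu gs)) (dirac1 R : G -> R).

(** A word of length at most [r] displaces [f] at most [r ^ 2] times as much as a
letter. *)
Lemma sqnorm_le_energy (f : G -> R) (ws : seq (seq I)) (r : nat) :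
  fin_supp f -> (forall x, 0 <= f x) -> tot f = 1 ->
  uniq [seq wprod gs w | w <- ws] -> (0 < size ws)%N ->
  (forall w, w \in ws -> (size w <= r)%N) ->
  sqnorm f <= (size ws)%:R^-1 + r%:R ^+ 2 * energy mu gs f / (2 * m).
Proof.
move=> sf f0 f1 uws ws0 wsr; have e0 := energy_ge0 gs mu0 f.
have -> : r%:R ^+ 2 * energy mu gs f / (2 * m) =
  (r%:R ^+ 2 * (energy mu gs f / m)) / 2 by field; rewrite gt_eqF.
rewrite -(size_map (wprod gs)); apply: nash; rewrite ?size_map//.
move=> _ /mapP[w /wsr wr ->].
have em : 0 <= energy mu gs f / m by rewrite divr_ge0// ltW.
apply: le_trans (displacement_wprod w sf em _) _.
  by move=> i; apply: displacement_le_energy.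
by rewrite ler_wpM2r// ler_sqr ?nnegrE// ler_nat.
Qed.

Lemma wprod_nseq i n : wprod gs (nseq n i) = (gs i ^+ n)%g.
Proof.
elim: n => [|n IH]; first by rewrite /wprod big_nil expg0.
by rewrite /wprod/= big_cons expgS -IH.
Qed.

(** The average [q] of the first [N] laws satisfies [q - T q = (law 0 - law N) / N], where
[T] is the step operator, so its energy is at most [2 / N].  The powers of [gs i0]
are the distinct points for the Nash inequality. *)
Lemma cesaro_law_le i0 N L z : injective (fun j => gs i0 ^+ j)%g -> (0 < N)%N -> (0 < L)%N ->
  ((\sum_(n < N) law n z) / N%:R) ^+ 2 <= L%:R^-1 + L%:R ^+ 2 / (N%:R * m).
Proof.
move=> ginj N0 L0; have Np : 0 < N%:R :> R by rewrite ltr0n.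
pose q x := N%:R^-1 * \sum_(n < N) law n x.
have slaw n : fin_supp (law n) by have [] := law_props gs mu0 mu1 n.
have law0 n x : 0 <= law n x by have [_ h _] := law_props gs mu0 mu1 n; exact: h.
have law1 n : tot (law n) = 1 by have [_ _ h] := law_props gs mu0 mu1 n.
have ssum : fin_supp (fun x => \sum_(n < N) law n x) by exact: fin_supp_sum.
have sq : fin_supp q by exact: fin_suppZ.
have q0 x : 0 <= q x by apply: mulr_ge0; [rewrite invr_ge0 ltW | apply: sumr_ge0].
have q1 : tot q = 1.
  rewrite totZ tot_sum//; under eq_bigr do rewrite law1.
  by rewrite sumr_const card_ord mulVf// gt_eqF.
have qle : q 1%g <= 1 by rewrite -q1; apply: le_tot_pt.
have step_q x : step_law mu gs q x = N%:R^-1 * \sum_(n < N) law n.+1 x.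
  rewrite [RHS](_ : _ = N%:R^-1 * \sum_(n < N) \sum_i mu i * ltrans (gs i) (law n) x)//.
  rewrite exchange_big mulr_sumr; apply: eq_bigr => i _.
  by rewrite -mulr_sumr mulrCA.
have E : energy mu gs q / 2 <= N%:R^-1.
  have -> : energy mu gs q / 2 = sqnorm q - tot (fun x => q x * step_law mu gs q x).
    by rewrite tot_mul_step//; ring.
  have s1 : fin_supp (fun x => - 1 * (q x * step_law mu gs q x)).
    exact/fin_suppZ/fin_suppM.
  rewrite -mulN1r -totZ -totD//; last exact: fin_supp_sqr.
  apply: (@le_trans _ _ (tot (fun x => N%:R^-1 * (dirac1 R x * q x)))); last first.
    by rewrite totZ tot_dirac_mul ler_piMr// invr_ge0 ltW.
  apply: le_tot.
  - by apply: fin_suppD => //; exact: fin_supp_sqr.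
  - by apply/fin_suppZ/fin_suppM/fin_supp_dirac.
  - move=> x; have -> : q x ^+ 2 + -1 * (q x * step_law mu gs q x) =
      q x * (q x - step_law mu gs q x) by ring.
    rewrite mulrA [leRHS]mulrC ler_wpM2l// step_q /q -mulrBr ler_wpM2l ?invr_ge0 ?(ltW Np)//.
    rewrite (sum_shift (fun n => law n x)).
    by rewrite -[dirac1 R x]/(law 0%N x) gerBl law0.
have -> : (\sum_(n < N) law n z) / N%:R = q z by rewrite mulrC.
apply: (@le_trans _ _ (sqnorm q)).
  by apply: (le_tot_pt z (fin_supp_sqr sq)) => x; apply: sqr_ge0.
pose ws := [seq nseq j i0 | j <- iota 0 L].
have szws : size ws = L by rewrite size_map size_iota.
apply: le_trans (sqnorm_le_energy (ws := ws) (r := L) sq q0 q1 _ _ _) _.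
- rewrite -map_comp map_inj_in_uniq ?iota_uniq// => a b _ _ /=.
  by rewrite !wprod_nseq => /ginj.
- by rewrite szws.
- by move=> w /mapP[j]; rewrite mem_iota add0n /= => jL ->; rewrite size_nseq ltnW.
rewrite szws lerD2l ler_pdivrMr ?mulr_gt0//.
have -> : L%:R ^+ 2 / (N%:R * m) * (2 * m) = L%:R ^+ 2 * (2 * N%:R^-1).
  by field; rewrite !gt_eqF.
by rewrite ler_wpM2l ?sqr_ge0//; lra.
Qed.


(** The excess of the squared norm over [1 / size ws] is at most a fixed multiple of the
energy, so each lazy step reduces it by a constant factor. *)
Lemma lazy_sqnorm_le (ws : seq (seq I)) (r n : nat) : m <= 1 -> (0 < r)%N ->
  uniq [seq wprod gs w | w <- ws] -> (0 < size ws)%N ->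
  (forall w, w \in ws -> (size w <= r)%N) ->
  sqnorm (lazy_law n) <= (size ws)%:R^-1 + (1 - m / (2 * r%:R ^+ 2)) ^+ n.
Proof.
move=> m1 r0 uws ws0 wsr; set e := (size ws)%:R^-1; set k := m / _.
have rp : 1 <= r%:R :> R by rewrite ler1n.
have e0 : 0 <= e by rewrite invr_ge0.
have kle : k <= 1.
  by rewrite ler_pdivrMr; nra.
rewrite -lerBlDl; elim: n => [|n IH].
  rewrite expr0 lerBlDr (_ : sqnorm _ = 1) ?lerDl//.
  rewrite -[RHS](@tot_dirac_mul G R (fun=> 1)); apply: eq_tot => x.
  by rewrite mulr1 /lazy_law/= /dirac1; case: eqP => _; rewrite ?expr1n ?expr0n.
have [sf f0 f1] := lazy_law_props gs mu0 mu1 n.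
apply: (@le_trans _ _ ((1 - k) * (sqnorm (lazy_law n) - e))); last first.
  by rewrite exprS ler_wpM2l// subr_ge0.
have h1 := sqnorm_lazy gs mu0 mu1 sf.
have h2 := sqnorm_le_energy sf f0 f1 uws ws0 wsr.
rewrite -/(lazy_law n) -/e in h1 h2.
have h3 : k * (sqnorm (lazy_law n) - e) <= energy mu gs (lazy_law n) / 4.
  have k0 : 0 < k by rewrite divr_gt0// mulr_gt0// exprn_gt0// (lt_le_trans ltr01).
  have -> : energy mu gs (lazy_law n) / 4 =
      k * (r%:R ^+ 2 * energy mu gs (lazy_law n) / (2 * m)).
    by rewrite /k; field; rewrite !gt_eqF// (lt_le_trans ltr01).
  by rewrite ler_pM2l// lerBlDl.
rewrite /lazy_law/= -/(lazy_law n); move: h1 h3.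
move: (sqnorm (lazy _ _)) (sqnorm (lazy_law n)) (energy _ _ _ / 4) => a b c; lra.
Qed.

Lemma nat_between_pow4 n : exists J, (J ^ 4 <= n < J.+1 ^ 4)%N.
Proof.
elim: n => [|n [J /andP[J1 J2]]]; first by exists 0%N.
have [h|h] := leqP (J.+1 ^ 4) n.+1.
  exists J.+1; rewrite h/=; apply: leq_ltn_trans J2 _.
  by rewrite ltn_exp2r.
by exists J; rewrite h (leq_trans J1).
Qed.

Definition exponential_growth := exists2 l, (0 < l)%N & forall J, exists ws : seq (seq I),
  [/\ size ws = (2 ^ J)%N, uniq [seq wprod gs w | w <- ws] &
      forall w, w \in ws -> (size w <= J * l)%N].

(** Take [J] the fourth root of [n]: the bound of [lazy_sqnorm_le] for words of length
[O(J)] is [2 ^ -J] plus a term of order [exp (- c n / J^2)], and both are exponentially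
small in [J]. *)
Lemma lazy_sqnorm_decay d : m <= 1 -> exponential_growth ->
  exists C : R, forall n, sqnorm (lazy_law n) * n.+1%:R ^+ d <= C.
Proof.
move=> m1 [l l0 Hl].
pose k := m / (2 * l%:R ^+ 2).
have lp : 0 < l%:R :> R by rewrite ltr0n.
have k0 : 0 < k by rewrite divr_gt0// mulr_gt0// exprn_gt0.
pose rho := (1 + k / 4)^-1.
have rho01 : 0 < rho < 1.
  have k4 : 0 < k / 4 by rewrite divr_gt0.
  by apply/andP; split; [rewrite invr_gt0 addr_gt0 | rewrite invf_lt1 ?ltrDl// addr_gt0].
have [C1 HC1] := @polynomial_exp_bounded R 2^-1 (4 * d) ltac:(lra).
have [C2 HC2] := @polynomial_exp_bounded R rho (4 * d) rho01.
exists (C1 + C2) => n.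
have [J /andP[J1 J2]] := nat_between_pow4 n.
have [ws [szws uws wsr]] := Hl J.+1.
have H : sqnorm (lazy_law n) <= 2^-1 ^+ J + rho ^+ J.
  apply: le_trans (lazy_sqnorm_le n m1 _ uws _ wsr) _.
  - by rewrite muln_gt0.
  - by rewrite szws expn_gt0.
  have -> : m / (2 * (J.+1 * l)%:R ^+ 2) = k / J.+1%:R ^+ 2 :> R.
    by rewrite /k natrM; field; rewrite !gt_eqF// ltr0n.
  set x := k / _.
  have x0 : 0 < x by rewrite divr_gt0// exprn_gt0// ltr0n.
  have kle : k <= 1.
    have l1 : 1 <= l%:R :> R by rewrite ler1n.
    by rewrite ler_pdivrMr ?mulr_gt0 ?exprn_gt0//; nra.
  have x1 : x <= 1.
    rewrite ler_pdivrMr ?exprn_gt0 ?ltr0n// mul1r.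
    by apply: le_trans kle _; rewrite exprn_ege1// ler1n.
  apply: lerD.
    by rewrite szws natrX exprVn lef_pV2 ?posrE ?exprn_gt0// ler_eXn2l ?ltr1n.
  apply: (@le_trans _ _ ((1 - x) ^+ (J ^ 4))).
    by rewrite ler_wiXn2l// ?subr_ge0// gerBl ltW.
  have -> : (J ^ 4 = J ^ 2 * J ^ 2)%N by rewrite -expnD.
  rewrite exprM; apply: (@le_trans _ _ (rho ^+ (J ^ 2))); last first.
    case/andP: rho01 => r0 r1; rewrite ler_wiXn2l// ?ltW//.
    by case: (J) => // j; rewrite expnS expn1 leq_pmulr.
  case: J {J1 J2 ws szws uws wsr} @x x0 x1 => [|J] x x0 x1; first by rewrite !expr0.
  have rho0 : 0 <= rho by case/andP: rho01 => /ltW.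
  apply: lerXn2r; rewrite ?nnegrE// ?exprn_ge0 ?subr_ge0//.
  apply: le_trans (bernoulli_inv_le _ _) _; first by rewrite ltW.
  have hk : 0 < 1 + k / 4 by rewrite addr_gt0// divr_gt0.
  rewrite /rho lef_pV2 ?posrE//; last by rewrite ltr_wpDr// mulr_ge0// ltW.
  rewrite lerD2l /x mulrCA ler_pM2l// natrX.
  have j1 : 1 <= J.+1%:R :> R by rewrite ler1n.
  have -> : J.+2%:R = J.+1%:R + 1 :> R by rewrite natr1.
  rewrite ler_pdivlMr ?exprn_gt0 ?addr_gt0//; nra.
have np : 0 <= n.+1%:R ^+ d :> R by rewrite exprn_ge0.
apply: le_trans (ler_wpM2r np H) _.
have nJ : n.+1%:R ^+ d <= J.+1%:R ^+ (4 * d) :> R.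
  by rewrite exprM; apply: lerXn2r; [rewrite nnegrE | rewrite nnegrE exprn_ge0 | rewrite -natrX ler_nat].
case/andP: rho01 => r0 r1.
apply: (@le_trans _ _ ((2^-1 ^+ J + rho ^+ J) * J.+1%:R ^+ (4 * d))).
  rewrite ler_wpM2l//; apply: addr_ge0; rewrite exprn_ge0// ?(ltW r0) ?invr_ge0//.
by rewrite mulrDl; apply: lerD; rewrite mulrC.
Qed.

(** The law is summed over at most [(n + 1) ^ k] points.  The inequality
[p <= t / 2 + p ^ 2 / (2 t)] with [t = (n + 1) ^ -(k + 2)] makes the number of points
harmless and leaves the squared norm, which decays fast enough to absorb [1 / t]. *)
Lemma lazy_visits_summable k (phi : G -> R) : m <= 1 -> exponential_growth ->
  (forall x, 0 <= phi x <= 1) ->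
  (forall n, exists2 zs : seq G, (size zs <= n.+1 ^ k)%N &
     forall x, lazy_law n x * phi x != 0 -> x \in zs) ->
  exists C : R, forall N, \sum_(n < N) iter n (lazy (step_mean mu gs)) phi 1%g <= C.
Proof.
move=> m1 grow phi01 Hzs.
have [C HC] := lazy_sqnorm_decay (k + 4) m1 grow.
exists (1 + C) => N.
have C0 : 0 <= C.
  by apply: le_trans (HC 0%N); rewrite mulr_ge0 ?sqnorm_ge0// exprn_ge0.
apply: (@le_trans _ _ (\sum_(n < N) (1 + C) / 2 * (n.+1%:R ^+ 2)^-1)); last first.
  rewrite -mulr_sumr; have := @sum_inv_sqr_le R N; move: (\sum_(n < N) _) => S; nra.
apply: ler_sum => n _.
have [sf f0 f1] := lazy_law_props gs mu0 mu1 n.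
rewrite -(tot_lazy_law_mul gs mu0 mu1) -/(lazy_law n).
have [zs szs Hz] := Hzs n.
rewrite (@tot_seq _ _ _ (undup zs)) ?undup_uniq//; last first.
  by move=> x /Hz; rewrite mem_undup.
pose a : R := n.+1%:R; have a0 : 0 < a by rewrite ltr0n.
pose t := (a ^+ (k + 2))^-1; have t0 : 0 < t by rewrite invr_gt0 exprn_gt0.
apply: (@le_trans _ _ (\sum_(x <- undup zs) (t / 2 + lazy_law n x ^+ 2 / (2 * t)))).
  apply: ler_sum => x _; apply: (@le_trans _ _ (lazy_law n x)).
    by rewrite ler_piMr//; [apply: f0 | case/andP: (phi01 x)].
  rewrite -subr_ge0.
  have -> : t / 2 + lazy_law n x ^+ 2 / (2 * t) - lazy_law n x =
    (t - lazy_law n x) ^+ 2 / (2 * t) by field; rewrite gt_eqF.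
  by rewrite divr_ge0 ?sqr_ge0// mulr_ge0// ltW.
rewrite big_split/= -[X in _ + X <= _]mulr_suml.
have sz : \sum_(x <- undup zs) t / 2 <= (a ^+ 2)^-1 / 2.
  rewrite -mulr_suml ler_pM2r// big_const_seq count_predT iter_addr_0 -mulr_natl.
  rewrite /t exprD invfM mulrA ler_piMl ?invr_ge0 ?exprn_ge0 ?(ltW a0)//.
  rewrite ler_pdivrMr ?exprn_gt0// mul1r -natrX ler_nat.
  exact: leq_trans (size_undup _) szs.
have sq : \sum_(x <- undup zs) lazy_law n x ^+ 2 <= sqnorm (lazy_law n).
  apply: (sum_uniq_le_tot (fin_supp_sqr sf)); last exact: undup_uniq.
  by move=> x; apply: sqr_ge0.
have dec : sqnorm (lazy_law n) / t <= C / a ^+ 2.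
  rewrite ler_pdivlMr ?exprn_gt0//; apply: le_trans (HC n).
  by rewrite /t invrK -mulrA -exprD -addnA.
have -> : (1 + C) / 2 / a ^+ 2 = (a ^+ 2)^-1 / 2 + C / a ^+ 2 / 2 by ring.
apply: lerD sz _.
rewrite invfM [2^-1 * _]mulrC mulrA ler_pM2r//.
by apply: le_trans dec; rewrite ler_pM2r// invr_gt0.
Qed.

Lemma step_mean_ge0 phi : (forall x, 0 <= phi x) -> forall x, 0 <= step_mean mu gs phi x.
Proof. by move=> p0 x; apply: sumr_ge0 => i _; apply: mulr_ge0; [exact: mu0 | exact: p0]. Qed.

Lemma lazy_mean_ge0 phi : (forall x, 0 <= phi x) ->
  forall x, 0 <= lazy (step_mean mu gs) phi x.
Proof. by move=> p0 x; rewrite divr_ge0// addr_ge0//; apply: step_mean_ge0. Qed.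

Lemma iter_lazy_mean_avg n (f h : G -> R) x :
  iter n (lazy (step_mean mu gs)) (fun y => (f y + h y) / 2) x =
  (iter n (lazy (step_mean mu gs)) f x + iter n (lazy (step_mean mu gs)) h x) / 2.
Proof.
elim: n f h => [//|n IH] f h; rewrite !iterSr -IH; congr (iter n _ _ x).
apply/funext => y; rewrite /lazy.
have -> : step_mean mu gs (fun y => (f y + h y) / 2) y =
    (step_mean mu gs f y + step_mean mu gs h y) / 2.
  rewrite /step_mean -big_split mulr_suml; apply: eq_bigr => i _ /=; ring.
ring.
Qed.

(** After [n] steps the lazy walk is the walk at a binomial time, and each time of the
walk lasts two lazy steps on average. *)
Lemma visits_summable k (phi : G -> R) : m <= 1 -> exponential_growth ->
  (forall x, 0 <= phi x <= 1) ->
  (forall n, exists2 zs : seq G, (size zs <= n.+1 ^ k)%N &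
     forall x, lazy_law n x * phi x != 0 -> x \in zs) ->
  exists C : R, forall N, \sum_(n < N) iter n (step_mean mu gs) phi 1%g <= C.
Proof.
move=> m1 grow phi01 Hzs; have [C HC] := lazy_visits_summable m1 grow phi01 Hzs.
exists C; apply: (lazy_series_le (A := fun n j =>
  iter n (lazy (step_mean mu gs)) (iter j (step_mean mu gs) phi) 1%g)) => //.
- move=> n j; have : forall x, 0 <= iter j (step_mean mu gs) phi x.
    elim: j => [|j IH] x /=; first by case/andP: (phi01 x).
    exact: step_mean_ge0.
  move: (iter j _ _) => f f0; elim: n 1%g => [|n IH] x //=.
  exact: lazy_mean_ge0.
- by move=> n j; rewrite iterSr -iter_lazy_mean_avg.
Qed.

End HeatKernel.

(** * Finite words weighted by their probability *)

Section FiniteExpectation.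
Context (R : realType) (I : finType) (mu : I -> R).
Hypothesis mu0 : forall i, 0 <= mu i.
Hypothesis mu1 : \sum_i mu i = 1.
Implicit Types F H : seq I -> R.

(** Expectation over words of [n] independent letters, by recursion on the first
letter so that the Markov property is [expect_cat]. *)
Fixpoint expect n F : R :=
  if n is n'.+1 then \sum_i mu i * expect n' (fun w => F (i :: w)) else F [::].

Lemma expect_le n F H : (forall w, size w = n -> F w <= H w) -> expect n F <= expect n H.
Proof.
elim: n F H => [|n IH] F H FH /=; first exact: FH.
apply: ler_sum => i _; apply: ler_wpM2l => //; apply: IH => w wn.
by apply: FH; rewrite /= wn.
Qed.

Lemma eq_expect n F H : (forall w, size w = n -> F w = H w) -> expect n F = expect n H.
Proof.
by move=> FH; apply/eqP; rewrite eq_le !expect_le// => w /FH ->.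
Qed.

Lemma expect_cst n (c : R) : expect n (fun=> c) = c.
Proof. by elim: n => [//|n /= ->]; rewrite -mulr_suml mu1 mul1r. Qed.

Lemma expect_ge0 n F : (forall w, 0 <= F w) -> 0 <= expect n F.
Proof. by move=> F0; rewrite -(expect_cst n 0); apply: expect_le. Qed.

Lemma expectZ n (c : R) F : expect n (fun w => c * F w) = c * expect n F.
Proof.
elim: n F => [//|n IH] F /=.
under eq_bigr => i _ do rewrite IH mulrCA.
by rewrite mulr_sumr.
Qed.

Lemma expect_sum n (J : Type) (r : seq J) (F : J -> seq I -> R) :
  expect n (fun w => \sum_(j <- r) F j w) = \sum_(j <- r) expect n (F j).
Proof.
elim: n F => [//|n IH] F /=.
under eq_bigr => i _ do rewrite IH mulr_sumr.
by rewrite exchange_big.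
Qed.

Lemma expect_cat n k F :
  expect (n + k) F = expect n (fun u => expect k (fun v => F (u ++ v))).
Proof.
by elim: n F => [//|n IH] F /=; apply: eq_bigr => i _; rewrite IH.
Qed.

Lemma expect_take n N F : (n <= N)%N -> expect N (fun w => F (take n w)) = expect n F.
Proof.
move=> nN; rewrite -(subnKC nN) expect_cat; apply: eq_expect => u un.
rewrite -[RHS](expect_cst (N - n)); apply: eq_expect => v _.
by rewrite take_size_cat.
Qed.

Section LeftWalk.
Context (G : groupType) (gs : I -> G).

(** The first letter of the word acts first, as in a left random walk. *)
Definition lprod (w : seq I) : G := foldl (fun x i => gs i * x)%g 1%g w.

Lemma lprod_cat u v : lprod (u ++ v) = (lprod v * lprod u)%g.
Proof.
rewrite /lprod foldl_cat.
elim/last_ind: v => [|v i IH]; first by rewrite /= mul1g.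
by rewrite !foldl_rcons IH mulgA.
Qed.

Lemma lprod1 i : lprod [:: i] = gs i.
Proof. by rewrite /lprod/= mulg1. Qed.

Lemma expect_lprod n (phi : G -> R) :
  expect n (fun w => phi (lprod w)) = iter n (step_mean mu gs) phi 1%g.
Proof.
suff H x : expect n (fun w => phi (lprod w * x)%g) = iter n (step_mean mu gs) phi x.
  by rewrite -H; apply: eq_expect => w _; rewrite mulg1.
elim: n x => [|n IH] x /=; first by rewrite mul1g.
apply: eq_bigr => i _; congr (_ * _); rewrite -IH; apply: eq_expect => w _.
by rewrite -cat1s lprod_cat lprod1 mulgA.
Qed.

Lemma expect_mem_le n (zs : seq G) : expect n (fun w => (lprod w \in zs)%:R) <=
  \sum_(z <- zs) expect n (fun w => (lprod w == z)%:R).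
Proof.
rewrite -expect_sum; apply: expect_le => w _.
elim: zs => [|z zs IH]; first by rewrite big_nil.
rewrite big_cons inE; case: eqP => _ /=; last by rewrite add0r.
by rewrite lerDl sumr_ge0.
Qed.

Lemma sum_window (E : pred nat) n0 N :
  (forall n n', E n -> E n' -> (n' < N)%N -> (n' < n + n0)%N) ->
  (\sum_(n < N) E n <= n0)%N.
Proof.
move=> H; have [[n1 En1]|nE] := pselect (exists n, E n); last first.
  rewrite big1// => i _; case: (boolP (E i)) => // Ei; by case: nE; exists (val i).
have [n2 En2 n2min] := ex_minnP (ex_intro _ n1 En1).
apply: (@leq_trans (\sum_(n < N) ((n2 <= n) && (n < n2 + n0))%N)).
  apply: leq_sum => i _; case: (boolP (E i)) => // Ei.
  by rewrite n2min//= (H n2 i).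
have : (\sum_(n < N) ((n2 <= n) && (n < n2 + n0)) <= minn n0 (N - n2))%N; last first.
  by move=> h; apply: leq_trans h (geq_minl _ _).
elim: {H} N => [|N IH]; first by rewrite big_ord0.
rewrite big_ord_recr/=; move: (\sum_(_ < _) _)%N IH => S; case: (leqP n2 N); case: (ltnP N (n2 + n0)) => /=; lia.
Qed.

Definition avoids1_after n0 (w : seq I) :=
  all (fun k => lprod (take k w) != 1%g) (iota n0 (size w - n0)).

(** When the walk is at [z] at time [n], it avoids [z] from time [n + n0] on with probability
at least [rho], by invariance under right translation.  On a given path, the times
[n] with this property lie in a window of length [n0]. *)
Lemma green_bounded n0 (rho : R) : 0 < rho ->
  (forall M, rho <= expect M (fun w => (avoids1_after n0 w)%:R)) ->
  forall z N, \sum_(n < N) expect n (fun w => (lprod w == z)%:R) <= n0%:R / rho.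
Proof.
move=> rho0 Hrho z N; rewrite ler_pdivlMr// mulr_suml.
pose E n (w : seq I) := (lprod (take n w) == z) &&
  all (fun k => lprod (take k w) != z) (iota (n + n0) (N - (n + n0))).
apply: (@le_trans _ _ (\sum_(n < N) expect N (fun w => (E n w)%:R))).
  apply: ler_sum => -[n nN] _ /=.
  have -> : N = (n + (N - n))%N by rewrite subnKC// ltnW.
  rewrite expect_cat mulrC -expectZ; apply: expect_le => u un.
  case: (eqVneq (lprod u) z) => [uz|_]; last first.
    by rewrite mulr0 expect_ge0// => w; rewrite ler0n.
  rewrite mulr1; apply: le_trans (Hrho (N - n)%N) _; apply: expect_le => v vN.
  rewrite ler_nat /E take_size_cat// uz eqxx/=.
  case: (boolP (avoids1_after n0 v)) => // /allP av; rewrite lt0b.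
  apply/allP => k; rewrite mem_iota => /andP[k1 k2].
  have -> : k = (size u + (k - n))%N by lia.
  rewrite take_cat ltnNge leq_addr/= addKn lprod_cat -[X in _ != X]mul1g uz.
  by rewrite (inj_eq (mulIg _)); apply: (av (k - n)%N); rewrite mem_iota vN; lia.
rewrite -expect_sum -[leRHS](expect_cst N); apply: expect_le => w wN.
rewrite -natr_sum ler_nat; apply: (@sum_window (fun n => E n w)) => a b /andP[Ea /allP Ha] /andP[Eb _] bN.
rewrite ltnNge; apply/negP => ab.
suff : lprod (take b w) != z by rewrite Eb.
by apply: (Ha b); rewrite mem_iota; lia.
Qed.

End LeftWalk.
End FiniteExpectation.

Lemma fsbig_finType (R : Type) (idx : R) (op : Monoid.com_law idx) (I : finType) (F : I -> R) :
  \big[op/idx]_(i \in [set: I]) F i = \big[op/idx]_i F i.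
Proof.
rewrite (_ : [set: I] = [set` enum I]); last first.
  by apply/seteqP; split => i _ //=; rewrite mem_enum.
by rewrite -fsbig_seq ?enum_uniq// big_enum.
Qed.

(** * Independent letters on a probability space *)

Section IidSequence.
Context (d : measure_display) (Omega : measurableType d) (R : realType).
Context (P : probability Omega R) (I : finType) (mu : I -> R) (J : nat -> Omega -> I).
Hypothesis mu0 : forall i, 0 <= mu i.
Hypothesis mu1 : \sum_i mu i = 1.

Definition history n (w : Omega) : seq I := mkseq (J^~ w) n.

Hypothesis Jmeas : forall n i, measurable [set w | J n w = i].
Hypothesis Jindep : forall v : seq I,
  P [set w | history (size v) w = v] = (\prod_(i <- v) mu i)%:E.

Lemma historyS n w : history n.+1 w = rcons (history n w) (J n w).
Proof. by rewrite /history mkseqS. Qed.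

Lemma size_history n w : size (history n w) = n.
Proof. exact: size_mkseq. Qed.

Lemma take_history n m w : (n <= m)%N -> take n (history m w) = history n w.
Proof.
move=> nm; rewrite /history /mkseq -map_take take_iota.
by rewrite (minn_idPl nm).
Qed.

Lemma measurable_cylinder (v : seq I) : measurable [set w | history (size v) w = v].
Proof.
elim/last_ind: v => [|v i IH].
  by rewrite (_ : [set _ | _] = setT)//; apply/seteqP; split.
rewrite size_rcons (_ : [set _ | _] = [set w | history (size v) w = v] `&` [set w | J (size v) w = i]).
  exact: measurableI.
apply/seteqP; split => w /=; rewrite historyS; first by move=> /rcons_inj[].
by move=> [-> ->].
Qed.

Lemma cylinder_split (B : pred (seq I)) v n :
  [set w | history (size v) w = v /\ B (history (size v + n.+1) w)] =
  \bigcup_(i in [set: I]) [set w | history (size (rcons v i)) w = rcons v i /\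
     B (history (size (rcons v i) + n) w)].
Proof.
apply/seteqP; split => w /=.
  move=> [hv hB]; exists (J (size v) w) => //=.
  by rewrite size_rcons addSnnS historyS hv.
move=> [i _] /=; rewrite size_rcons addSnnS historyS => -[/rcons_inj[hv _] hB].
by split.
Qed.

Lemma measurable_prefixed (B : pred (seq I)) v n :
  measurable [set w | history (size v) w = v /\ B (history (size v + n) w)].
Proof.
elim: n v => [|n IH] v.
  rewrite addn0; have [Bv|nBv] := boolP (B v).
    rewrite (_ : [set _ | _] = [set w | history (size v) w = v]).
      exact: measurable_cylinder.
    by apply/seteqP; split => w /= [] // ->.
  rewrite (_ : [set _ | _] = set0)//; apply/seteqP; split => w //= -[->].
  by rewrite (negPf nBv).
by rewrite cylinder_split; apply: fin_bigcup_measurable => // ; exact: finite_finset.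
Qed.

(** The prefix [v] allows an induction on [n] that splits the event along its next
letter. *)
Lemma prob_prefixed (B : pred (seq I)) v n :
  P [set w | history (size v) w = v /\ B (history (size v + n) w)] =
  (\prod_(i <- v) mu i * expect mu n (fun u => (B (v ++ u))%:R))%:E.
Proof.
elim: n v => [|n IH] v.
  rewrite addn0 /= cats0; have [Bv|nBv] := boolP (B v).
    rewrite (_ : [set _ | _] = [set w | history (size v) w = v]) ?Jindep ?mulr1//.
    by apply/seteqP; split => w /= [] // ->.
  rewrite (_ : [set _ | _] = set0) ?measure0 ?mulr0//; apply/seteqP; split => w //= -[->].
  by rewrite (negPf nBv).
rewrite cylinder_split measure_fin_bigcup//.
- rewrite fsbig_finType; transitivity (\sum_i (\prod_(j <- rcons v i) mu j *
      expect mu n (fun u => (B (rcons v i ++ u))%:R))%:E)%E.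
    by apply: eq_bigr => i _; exact: IH.
  rewrite sumEFin /= mulr_sumr; congr (_%:E); apply: eq_bigr => i _.
  rewrite big_rcons/= -mulrA; congr (_ * (_ * _)).
  by apply: eq_expect => // u _; rewrite cat_rcons.
- exact: finite_finset.
- move=> i j _ _ [w /= [[hi _] [hj _]]].
  by move: hj; rewrite !size_rcons in hi *; rewrite hi => /rcons_inj[].
- by move=> i _; apply: measurable_prefixed.
Qed.

Lemma measurable_history (B : pred (seq I)) n : measurable [set w | B (history n w)].
Proof.
have := measurable_prefixed B [::] n; congr (measurable _).
by apply/seteqP; split => w //= -[].
Qed.

Lemma prob_history (B : pred (seq I)) n :
  P [set w | B (history n w)] = (expect mu n (fun u => (B u)%:R))%:E.
Proof.
have := prob_prefixed B [::] n; rewrite big_nil mul1r => <-; congr (P _).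
by apply/seteqP; split => w //= -[].
Qed.

Lemma borel_cantelli_history (k : nat -> nat) (B : nat -> pred (seq I)) (C : R) :
  (forall N, \sum_(n < N) expect mu (k n) (fun u => (B n u)%:R) <= C) ->
  {ae P, forall w, exists n0, forall n, (n0 <= n)%N -> ~~ B n (history (k n) w)}.
Proof.
move=> HC; pose F n := [set w | B n (history (k n) w)].
have mF n : measurable (F n) by exact: measurable_history.
have F0 : P (lim_sup_set F) = 0.
  apply: lim_sup_set_cvg0 => //.
  apply: (@le_lt_trans _ _ C%:E); last exact: ltry.
  apply: lime_le; first by apply: is_cvg_nneseries => n _ _; apply: measure_ge0.
  apply: nearW => N; rewrite big_mkord.
  have -> : (\sum_(n < N) P (F n) =
      \sum_(n < N) (expect mu (k n) (fun u => (B n u)%:R))%:E)%E.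
    by apply: eq_bigr => i _; exact: prob_history.
  by rewrite sumEFin lee_fin.
exists (lim_sup_set F); split => //.
  by apply: bigcapT_measurable => n; apply: bigcup_measurable.
move=> w /= nH n _; apply: contrapT => H; apply: nH; exists n => m nm.
by apply/negP => Bm; apply: H; exists m.
Qed.

Section OnGroup.
Context (G : groupType) (gs : I -> G).
Let pos n w : G := lprod gs (history n w).

(** If the walk almost never stopped returning to 1 after any given time, it would
return infinitely often almost surely. *)
Lemma transient_green : ~ {ae P, forall w, infinite_set [set n | pos n w = 1%g]} ->
  exists C : R, forall z N,
    \sum_(n < N) expect mu n (fun u => (lprod gs u == z)%:R) <= C.
Proof.
move=> ntr.
pose Q n0 M := [set w | avoids1_after gs n0 (history M w)].
pose F n0 := \bigcap_M Q n0 M.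
have mF n0 : measurable (F n0).
  by apply: bigcapT_measurable => M; apply: measurable_history.
have [n0 Fn0] : exists n0, P (F n0) != 0%E.
  apply: contrapT => nF; apply: ntr.
  have F0 n0 : P (F n0) = 0%E by apply: contrapT => /eqP h; apply: nF; exists n0.
  have : P.-negligible (\bigcup_n0 F n0).
    by apply: negligible_bigcup => n0; exists (F n0); split => //; exact: F0.
  apply: negligibleS => w /= /contrapT /finite_seqP[s sE].
  exists (\max_(k <- s) k).+1 => // M _; apply/allP => k.
  rewrite size_history mem_iota => /andP[k1 k2].
  rewrite take_history; last by lia.
  apply: contraTneq k1 => kE; rewrite -ltnNge ltnS.
  have ks : k \in s by have : [set n | pos n w = 1%g] k by []; rewrite sE.
  by rewrite (big_rem k ks)/= leq_maxl.
have [p pE] : exists p : R, P (F n0) = p%:E.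
  by exists (fine (P (F n0))); rewrite fineK// fin_num_measure.
have p0 : 0 < p.
  by rewrite lt0r -lee_fin -pE measure_ge0 andbT -eqe -pE.
exists (n0%:R / p); apply: green_bounded => // M.
rewrite -lee_fin -pE -prob_history; apply: le_measure; rewrite ?inE//.
- exact: measurable_history.
- by move=> w; apply.
Qed.

Lemma transient_leaves_list (zs : seq G) :
  ~ {ae P, forall w, infinite_set [set n | pos n w = 1%g]} ->
  {ae P, forall w, exists n0, forall n, (n0 <= n)%N -> pos n w \notin zs}.
Proof.
move=> /transient_green[C HC].
apply: (borel_cantelli_history (k := id) (B := fun _ u => lprod gs u \in zs)
  (C := (size zs)%:R * C)) => N.
apply: (@le_trans _ _ (\sum_(z <- zs) \sum_(n < N) expect mu n (fun u => (lprod gs u == z)%:R))).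
  by rewrite exchange_big/=; apply: ler_sum => n _; apply: expect_mem_le.
have -> : (size zs)%:R * C = \sum_(z <- zs) C.
  by rewrite big_const_seq count_predT iter_addr_0 mulr_natl.
by apply: ler_sum => z _; apply: HC.
Qed.

(** Markov's inequality and Borel-Cantelli.  Along the times [64 ^ j] the mean density
of visits is summable, since it decays like [2 ^ -j]. *)
Lemma rare_visits (zs : seq G) (c : R) :
  (forall j, \sum_(n < 64 ^ j) expect mu n (fun u => (lprod gs u \in zs)%:R) <=
     c * (64 ^ j)%:R * 2^-1 ^+ j) ->
  {ae P, forall w (t : nat), exists j0, forall j, (j0 <= j)%N ->
     ((\sum_(n < 64 ^ j) (pos n w \in zs)) * t < 64 ^ j)%N}.
Proof.
move=> Hc; apply/ae_foralln => t.
pose B j (u : seq I) := (64 ^ j <= (\sum_(n < 64 ^ j) (lprod gs (take n u) \in zs)) * t)%N.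
have c0 : 0 <= c.
  have := Hc 0%N; rewrite expn0 expr0 !mulr1; apply: le_trans.
  by apply: sumr_ge0 => n _; apply: expect_ge0 => // u; rewrite ler0n.
have BC : forall N, \sum_(j < N) expect mu (64 ^ j)%N (fun u => (B j u)%:R) <= t%:R * c * 2.
  move=> N; apply: (@le_trans _ _ (\sum_(j < N) t%:R * c * 2^-1 ^+ j)).
    apply: ler_sum => j _; have M0 : 0 < (64 ^ j)%:R :> R by rewrite ltr0n expn_gt0.
    apply: (@le_trans _ _ (expect mu (64 ^ j)%N (fun u =>
        t%:R / (64 ^ j)%:R * \sum_(n < 64 ^ j) (lprod gs (take n u) \in zs)%:R))).
      apply: expect_le => // u _; case: (boolP (B j u)) => [Bu|_]; last first.
        by rewrite mulr_ge0 ?divr_ge0// sumr_ge0.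
      rewrite mulrAC ler_pdivlMr// mul1r mulrC -natr_sum -natrM ler_nat.
      exact: Bu.
    rewrite expectZ expect_sum mulrAC ler_pdivrMr//.
    rewrite (_ : t%:R * c * _ * _ = t%:R * (c * (64 ^ j)%:R * 2^-1 ^+ j)); last by ring.
    rewrite ler_wpM2l//; apply: le_trans (Hc j).
    apply: ler_sum => n _.
    by rewrite (expect_take mu0 mu1 (fun u => (lprod gs u \in zs)%:R) (ltnW (ltn_ord n))).
  rewrite -mulr_sumr ler_wpM2l ?mulr_ge0//.
  suff : \sum_(j < N) 2^-1 ^+ j = 2 - 2 * 2^-1 ^+ N :> R.
    by move=> ->; rewrite gerBl mulr_ge0// exprn_ge0// invr_ge0.
  elim: N => [|N IH]; first by rewrite big_ord0 expr0 mulr1 subrr.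
  by rewrite big_ord_recr/= IH exprS; field.
have := borel_cantelli_history BC; apply: filterS => w [j0 Hj0].
exists j0 => j /Hj0; rewrite /B -ltnNge; congr (_ * _ < _)%N.
by apply: eq_bigr => n _; rewrite take_history// ltnW.
Qed.

End OnGroup.
End IidSequence.

(** Between two consecutive powers of 64 the count is monotone, so the density is lost
only up to a factor 64, which the arbitrary integer [t] absorbs. *)
Lemma density_cvg0 (R : realType) (f : nat -> bool) :
  (forall t : nat, exists j0, forall j, (j0 <= j)%N -> ((\sum_(n < 64 ^ j) f n) * t < 64 ^ j)%N) ->
  ((count f (index_iota 1 N.+1))%:R / N%:R : R) @[N --> \oo] --> (0 : R).
Proof.
move=> H; apply/cvgrPdist_lt => e e0.
have := archi_boundP (ltW (divr_gt0 (ltr0n R 64) e0)).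
set t := Num.bound _ => te; have [j0 Hj0] := H t.
near=> N.
have N0 : (0 < N)%N by near: N; exists 1%N.
have Np : 0 < N%:R :> R by rewrite ltr0n.
have Nj : (64 ^ j0 <= N)%N by near: N; exists (64 ^ j0)%N.
have /andP[l1 l2] := @trunc_log_bounds 64 N isT N0.
set j := trunc_log 64 N in l1 l2.
have jj : (j0 <= j.+1)%N by rewrite ltnW// ltnS trunc_log_max.
have cle : (count f (index_iota 1 N.+1) <= \sum_(n < 64 ^ j.+1) f n)%N.
  have -> : (\sum_(n < 64 ^ j.+1) f n = count f (iota 0 (64 ^ j.+1)))%N.
    rewrite -sum1_count [RHS]big_mkcond -(big_mkord xpredT (fun n => nat_of_bool (f n))).
    by rewrite /index_iota subn0; apply: eq_bigr => i _; case: (f i).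
  have -> : (64 ^ j.+1 = 1 + (N + (64 ^ j.+1 - N.+1)))%N by lia.
  by rewrite !iotaD !count_cat /index_iota subn1 addnCA leq_addr.
have := leq_ltn_trans (leq_mul cle (leqnn t)) (Hj0 _ jj).
move: (count _ _) => m; rewrite expnS => mt.
have {}mt : (m * t < 64 * N)%N by apply: leq_trans mt _; rewrite leq_mul2l l1 orbT.
rewrite sub0r normrN ger0_norm ?divr_ge0// ltr_pdivrMr//.
rewrite ltr_pdivrMr// in te.
have t0 : 0 < t%:R :> R by rewrite -(pmulr_lgt0 _ e0); apply: lt_trans te.
rewrite -(ltr_pM2r t0) -natrM; apply: (@lt_trans _ _ (64 * N)%:R); first by rewrite ltr_nat.
by rewrite natrM (_ : e * _ * _ = t%:R * e * N%:R) ?ltr_pM2r//; ring.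
Unshelve. all: by end_near.
Qed.
(** * Random walks of affine maps *)

Section AffineWalks.
Context (K : fieldType) (R : realType) (I : finType) (gs : I -> aff K).

Lemma aff_linM (g h : aff K) : aff_lin (g * h)%g = aff_lin g * aff_lin h.
Proof. by []. Qed.

Lemma aff_transM (g h : aff K) :
  aff_trans (g * h)%g = aff_lin g * aff_trans h + aff_trans g.
Proof. by []. Qed.

Lemma aff_lin1 : aff_lin (1%g : aff K) = 1. Proof. by []. Qed.
Lemma aff_trans1 : aff_trans (1%g : aff K) = 0. Proof. by []. Qed.

Lemma aff_linX (g : aff K) n : aff_lin (g ^+ n)%g = aff_lin g ^+ n.
Proof. by elim: n => [|n IH]; rewrite ?expg0 ?aff_lin1 ?expr0// expgS aff_linM IH exprS. Qed.

Lemma aff_linV (g : aff K) : aff_lin (g^-1)%g = (aff_lin g)^-1.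
Proof. by []. Qed.

Let lins := [seq aff_lin (gs i) | i <- enum I].

Lemma lins_neq0 c : c \in lins -> c != 0.
Proof. by move=> /mapP[i _ ->]; apply: aff_lin_neq0. Qed.

Lemma gen_lin_wprod w : gen (fun y => y \in lins) (aff_lin (wprod gs w)).
Proof.
elim: w => [|i w IH]; first by rewrite /wprod big_nil; exact: gen1.
rewrite /wprod big_cons aff_linM; apply: gen_stepM IH.
by apply: map_f; rewrite mem_enum.
Qed.

Lemma lprod_rcons (G : groupType) (hs : I -> G) w i :
  lprod hs (rcons w i) = (hs i * lprod hs w)%g.
Proof. by rewrite /lprod foldl_rcons. Qed.

Lemma gen_lin_lprod w : gen (fun y => y \in lins) (aff_lin (lprod gs w)).
Proof.
elim/last_ind: w => [|w i IH]; first exact: gen1.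
rewrite lprod_rcons aff_linM; apply: gen_stepM IH.
by apply: map_f; rewrite mem_enum.
Qed.

Lemma wprod_cat (G : groupType) (hs : I -> G) u v :
  wprod hs (u ++ v) = (wprod hs u * wprod hs v)%g.
Proof. by rewrite /wprod big_cat. Qed.

(** Let [U = g_i g_j g_i0 ^ q] and [V = g_j g_i g_i0 ^ q].  They have the same linear part,
which is not a height-one root for a suitable [q], and different translation parts
since [g_i] and [g_j] do not commute.  Hence they generate a free semigroup, and the
products of [J] factors [U] or [V] have [2 ^ J] values. *)
Lemma affine_exponential_growth i0 i j :
  (forall n, (0 < n)%N -> aff_lin (gs i0) ^+ n != 1) ->
  (gs i * gs j)%g != (gs j * gs i)%g -> exponential_growth gs.
Proof.
move=> nru nc.
have [q hq] : exists q, ~ height1_root (aff_lin (wprod gs ([:: i; j] ++ nseq q i0))).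
  apply: (@gen_height1_escape K lins (fun q => aff_lin (wprod gs ([:: i; j] ++ nseq q i0)))).
  - exact: lins_neq0.
  - by move=> n; apply: gen_lin_wprod.
  - have W n : aff_lin (wprod gs ([:: i; j] ++ nseq n i0)) =
        aff_lin (wprod gs [:: i; j]) * aff_lin (gs i0) ^+ n.
      by rewrite wprod_cat aff_linM wprod_nseq aff_linX.
    move=> a b /=; rewrite !W => /(mulfI (aff_lin_neq0 _)).
    exact: expr_inj (aff_lin_neq0 _) nru _ _.
pose U := [:: i; j] ++ nseq q i0; pose V := [:: j; i] ++ nseq q i0.
have lUV : aff_lin (wprod gs V) = aff_lin (wprod gs U).
  by rewrite !wprod_cat /wprod !big_cons !big_nil !aff_linM; ring.
have free : free_semigroup (wprod gs U) (wprod gs V).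
  apply: free_semigroup_aff => // tUV; move/eqP: nc; apply.
  have : wprod gs U = wprod gs V by apply: aff_eq.
  rewrite !wprod_cat => /mulIg.
  by rewrite /wprod !big_cons !big_nil !mulg1.
exists (q + 2)%N; first by rewrite addn2.
move=> n; pose W (t : n.-tuple bool) := flatten [seq (if b then U else V) | b <- t].
have WE (t : seq bool) : wprod gs (flatten [seq (if b then U else V) | b <- t]) =
    word (wprod gs U) (wprod gs V) t.
  elim: t => [|b t IH]; first by rewrite /wprod /word !big_nil.
  by rewrite /= wprod_cat IH /word big_cons; case: b.
exists [seq W t | t <- enum {: n.-tuple bool}]; split.
- by rewrite size_map -cardE card_tuple card_bool.
- rewrite -map_comp map_inj_in_uniq ?enum_uniq// => t t' _ _ /=.
  rewrite !WE; case: n t t' @W => [|n] t t' _ e; first by rewrite (tuple0 t) (tuple0 t').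
  apply/eqP; apply/negPn/negP => tt'; apply: free e; rewrite -?size_eq0 ?size_tuple//.
- move=> w /mapP[t _ ->]; rewrite size_flatten /shape -map_comp.
  rewrite (eq_map (g := fun=> (q + 2)%N)); last first.
    by case=> /=; rewrite size_nseq addn2.
  by rewrite sumnE big_map big_const_seq count_predT iter_addn_0 size_tuple mulnC.
Qed.

Context (mu : I -> R).
Let lazy_law n := iter n (lazy (step_law mu gs)) (dirac1 R : aff K -> R).

(** Only the multiplicities of the letters matter for the linear part, so it takes
polynomially many values. *)
Lemma lazy_law_lin n x : lazy_law n x != 0 ->
  exists e : {ffun I -> 'I_n.+1}, aff_lin x = \prod_i aff_lin (gs i) ^+ e i.
Proof.
elim: n x => [|n IH] x.
  rewrite /lazy_law/= /dirac1; case: (x =P 1%g) => [->|_]; last by rewrite eqxx.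
  move=> _; exists [ffun=> ord0]; rewrite big1// => i _.
  by rewrite ffunE expr0.
have [hx _|hx] := boolP (lazy_law n x != 0).
  have [e ->] := IH x hx; exists [ffun i => widen_ord (leqnSn n.+1) (e i)].
  by apply: eq_bigr => i _; rewrite ffunE.
move: hx; rewrite negbK => /eqP hx.
rewrite /lazy_law/= -/(lazy_law n) /lazy hx add0r => h.
have [i hi] : exists i, lazy_law n ((gs i)^-1 * x)%g != 0.
  apply: contrapT => H; case/negP: h; rewrite /step_law big1 ?mul0r// => i _.
  apply/eqP; rewrite mulf_eq0; apply/orP; right; apply: contrapT => /negP hi.
  by apply: H; exists i.
have [e eE] := IH _ hi.
have b k : ((e k + (k == i)) < n.+2)%N.
  by have := ltn_ord (e k); case: (k == i); lia.
exists [ffun k => Ordinal (b k)].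
under eq_bigr do rewrite ffunE/= exprD.
rewrite big_split/= -eE aff_linM aff_linV mulrAC.
rewrite (bigD1 i)//= eqxx expr1 big1 ?mulr1; last first.
  by move=> k /negPf ->; rewrite expr0.
by rewrite mulVf ?mul1r// aff_lin_neq0.
Qed.

(** Homotheties represent the walk of linear parts as a walk in the affine group; the
value at 0 is junk. *)
Definition homothety (z : K) : aff K := insubd (1%g : aff K) (z, 0 : K).

Lemma homothetyE (x : aff K) : aff_trans x = 0 -> x = homothety (aff_lin x).
Proof.
move=> x0; apply: val_inj; rewrite /homothety val_insubd/= aff_lin_neq0.
by rewrite -x0 /aff_lin /aff_trans -surjective_pairing.
Qed.

Lemma fixing0_support n : exists2 zs : seq (aff K), (size zs <= n.+1 ^ #|I|)%N &
  forall x, lazy_law n x * (aff_trans x == 0)%:R != 0 -> x \in zs.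
Proof.
exists [seq homothety (\prod_i aff_lin (gs i) ^+ (e : {ffun I -> 'I_n.+1}) i) |
    e <- enum {ffun I -> 'I_n.+1}].
  by rewrite size_map -cardE card_ffun card_ord.
move=> x; case: (aff_trans x =P 0) => [x0|_]; last by rewrite mulr0 eqxx.
rewrite mulr1 => /lazy_law_lin[e xe]; apply/mapP; exists e; first by rewrite mem_enum.
by rewrite -xe; apply: homothetyE.
Qed.

(** A map with linear part different from 1 has a unique fixed point, which every map
that commutes with it preserves. *)
Lemma commuting_fixed_point i0 : aff_lin (gs i0) != 1 ->
  (forall i j, (gs i * gs j)%g = (gs j * gs i)%g) ->
  exists x, forall i, aff_fun (gs i) x = x.
Proof.
move=> a1 comm.
pose a := aff_lin (gs i0); pose x := aff_trans (gs i0) / (1 - a).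
have a10 : 1 - a != 0 by rewrite subr_eq0 eq_sym.
have fix_x y : aff_fun (gs i0) y = y -> y = x.
  rewrite /aff_fun -/a => h; apply: (mulIf a10); rewrite /x divfK// mulrBr mulr1 -{1}h; ring.
have x_fix : aff_fun (gs i0) x = x.
  by rewrite /aff_fun -/a /x; field.
exists x => i; apply: fix_x.
have := congr1 (fun g => aff_fun g x) (comm i i0).
by rewrite /= !aff_funM /= x_fix => /esym.
Qed.

Lemma lprod_fixed x w : (forall i, aff_fun (gs i) x = x) -> aff_fun (lprod gs w) x = x.
Proof.
move=> H; elim/last_ind: w => [|w i IH].
  by rewrite /aff_fun aff_lin1 aff_trans1 mul1r addr0.
by rewrite lprod_rcons aff_funM /= IH.
Qed.

End AffineWalks.

(** * Pairs of affine maps with a common linear part *)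

Section PairWalk.
Context (K : fieldType) (R : realType).
Context (d : measure_display) (Omega : measurableType d) (P : probability Omega R).
Context (I : finType) (mu : I -> R) (J : nat -> Omega -> I).
Hypothesis mu_gt0 : forall i, 0 < mu i.
Hypothesis mu1 : \sum_i mu i = 1.
Hypothesis Jmeas : forall n i, measurable [set w | J n w = i].
Hypothesis Jindep : forall v : seq I,
  P [set w | history J (size v) w = v] = (\prod_(i <- v) mu i)%:E.
Context (gs : I -> (aff K * aff K)%type).
Hypothesis gs_lin : forall i, aff_lin (gs i).1 = aff_lin (gs i).2.
Context (i0 i1 : I).
Hypothesis i0_unity : ~ is_root_of_unity (aff_lin (gs i0).1).
Hypothesis i1_diag : (gs i1).1 <> (gs i1).2.

Let mu0 i : 0 <= mu i. Proof. exact: ltW. Qed.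
Let m := \prod_i mu i.

Let mu_le1 i : mu i <= 1.
Proof. by rewrite -mu1 (bigD1 i)//= lerDl sumr_ge0. Qed.

Let m_gt0 : 0 < m. Proof. by apply: prodr_gt0. Qed.

Let m_le i : m <= mu i.
Proof.
rewrite /m (bigD1 i)//= ler_piMr// prodr_ile1// => j _; by rewrite mu0 mu_le1.
Qed.

Let m_le1 : m <= 1. Proof. exact: le_trans (m_le i0) (mu_le1 i0). Qed.

(** On pairs with a common linear part this is a group morphism; its translation part
vanishes exactly on the diagonal. *)
Definition diff_aff (g : (aff K * aff K)%type) : aff K :=
  @Aff K (aff_lin g.1, aff_trans g.1 - aff_trans g.2) (aff_lin_neq0 g.1).

Let pos n w := lprod gs (history J n w).
Let ga i := homothety (aff_lin (gs i).1).
Let gd i := diff_aff (gs i).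

Lemma aff_lin_homothety (z : K) : z != 0 -> aff_lin (homothety z) = z.
Proof. by move=> z0; rewrite /aff_lin val_insubd/= z0. Qed.

Lemma aff_trans_homothety (z : K) : aff_trans (homothety z) = 0.
Proof. by rewrite /aff_trans val_insubd/=; case: ifP. Qed.

Lemma aff_lin_diff g : aff_lin (diff_aff g) = aff_lin g.1.
Proof. by []. Qed.

Lemma aff_trans_diff g : aff_trans (diff_aff g) = aff_trans g.1 - aff_trans g.2.
Proof. by []. Qed.

Lemma lprod_pair_lin w : aff_lin (lprod gs w).1 = aff_lin (lprod gs w).2.
Proof.
elim/last_ind: w => [//|w i IH].
by rewrite lprod_rcons !aff_linM IH gs_lin.
Qed.

Lemma lprod_diff w : diff_aff (lprod gs w) = lprod gd w.
Proof.
elim/last_ind: w => [|w i IH].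
  by apply: aff_eq; rewrite ?aff_trans_diff ?subrr.
rewrite !lprod_rcons -IH; apply: aff_eq; first by rewrite aff_lin_diff !aff_linM.
rewrite aff_trans_diff !aff_transM !aff_trans_diff aff_lin_diff gs_lin; ring.
Qed.

Lemma lprod_homothety w : homothety (aff_lin (lprod gs w).1) = lprod ga w.
Proof.
symmetry; have H : aff_trans (lprod ga w) = 0 /\ aff_lin (lprod ga w) = aff_lin (lprod gs w).1.
  elim/last_ind: w => [//|w i [IH1 IH2]].
  rewrite !lprod_rcons aff_transM !aff_linM IH1 IH2 aff_trans_homothety mulr0 addr0.
  by rewrite aff_lin_homothety// aff_lin_neq0.
by case: H => t0 <-; apply: homothetyE.
Qed.

Lemma i0_expn n : (0 < n)%N -> aff_lin (gs i0).1 ^+ n != 1.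
Proof.
move=> n0; apply/eqP => h; apply: i0_unity; exists n => //.
exact/unity_rootP.
Qed.

Lemma not_free_diff0 w : ~ free_semigroup (lprod gs w).1 (lprod gs w).2 ->
  aff_trans (lprod gd w) = 0 \/ height1_root (aff_lin (lprod gs w).1).
Proof.
move=> nf; have [h|h] := pselect (height1_root (aff_lin (lprod gs w).1)); first by right.
left; apply: contrapT => t0; apply: nf; apply: free_semigroup_aff => //.
  by rewrite lprod_pair_lin.
by move=> e; apply: t0; rewrite -lprod_diff aff_trans_diff e subrr.
Qed.

(** A letter off the diagonal moves 0, so the common fixed point is not 0.  A product
that fixes 0 then fixes two points and has linear part 1. *)
Lemma diff_fixes0_height1 : (forall i j, (gd i * gd j)%g = (gd j * gd i)%g) ->
  forall w, aff_trans (lprod gd w) = 0 -> height1_root (aff_lin (lprod gs w).1).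
Proof.
move=> comm.
have [|x xfix] := @commuting_fixed_point K I gd i0 _ comm.
  by have := @i0_expn 1%N isT; rewrite expr1.
have x0 : x != 0.
  apply/eqP => xz; apply: i1_diag.
  have := xfix i1; rewrite xz /aff_fun mulr0 add0r aff_trans_diff => /eqP.
  by rewrite subr_eq0 => /eqP; apply: aff_eq.
move=> w t0; apply: (@unity_root_height1 _ _ 1%N) => //.
have := @lprod_fixed K I gd x w xfix; rewrite /aff_fun t0 addr0 -lprod_diff aff_lin_diff => h.
by rewrite expr1; apply: (mulIf x0); rewrite h mul1r.
Qed.

(** If the difference maps commute this holds at all times by [diff_fixes0_height1].
Otherwise they have exponential growth, and the difference walk fixes 0 only
finitely often. *)
Lemma eventually_height1 : {ae P, forall w, exists n0, forall n, (n0 <= n)%N ->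
  ~ free_semigroup (pos n w).1 (pos n w).2 -> height1_root (aff_lin (pos n w).1)}.
Proof.
have [comm|] := pselect (forall i j, (gd i * gd j)%g = (gd j * gd i)%g).
  apply: aeW => w; exists 0%N => n _ /not_free_diff0[|//].
  exact: diff_fixes0_height1.
move=> /existsNP[i /existsNP[j /eqP nc]].
have grow : exponential_growth gd :=
    @affine_exponential_growth K I gd i0 i j i0_expn nc.
pose phi (x : aff K) : R := (aff_trans x == 0)%:R.
have phi01 x : 0 <= phi x <= 1 by rewrite ler0n lern1 leq_b1.
have [C HC] := visits_summable mu1 m_gt0 m_le m_le1 grow phi01 (fixing0_support gd mu).
have BC N : \sum_(n < N) expect mu n (fun u => (aff_trans (lprod gd u) == 0)%:R) <= C.
  apply: le_trans (HC N); apply: ler_sum => n _.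
  by rewrite -(expect_lprod mu0 gd).
have := borel_cantelli_history mu0 Jmeas Jindep (k := id)
  (B := fun _ u => aff_trans (lprod gd u) == 0) BC.
apply: filterS => w [n0 Hn0]; exists n0 => n nn0 /not_free_diff0[t0|//].
by have := Hn0 n nn0; rewrite t0 eqxx.
Qed.

Lemma height1_list : exists zs : seq (aff K), forall w,
  height1_root (aff_lin (lprod gs w).1) -> lprod ga w \in zs.
Proof.
have := @finite_height1_root K [seq aff_lin (ga i) | i <- enum I].
move=> /(_ (@lins_neq0 _ _ _)) /finite_seqP[s sE].
exists [seq homothety z | z <- s] => w hw; rewrite -lprod_homothety; apply: map_f.
suff : [set` s] (aff_lin (lprod gs w).1) by [].
rewrite -sE; split => //.
have := gen_lin_lprod ga w; rewrite -lprod_homothety.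
by rewrite aff_lin_homothety// aff_lin_neq0.
Qed.

(** This is [cesaro_law_le] with [L = 4 ^ j] and [N = L ^ 3], which balances its two terms. *)
Lemma visit_average_le z j : \sum_(n < 64 ^ j) expect mu n (fun u => (lprod ga u == z)%:R) <=
  (1 + m^-1) * (64 ^ j)%:R * 2^-1 ^+ j.
Proof.
have N0 : (0 < 64 ^ j)%N by rewrite expn_gt0.
have Np : 0 < (64 ^ j)%:R :> R by rewrite ltr0n.
have L0 : (0 < 4 ^ j)%N by rewrite expn_gt0.
have ginj : injective (fun k => ga i0 ^+ k)%g.
  move=> a b /(congr1 (@aff_lin K)); rewrite !aff_linX !aff_lin_homothety ?aff_lin_neq0//.
  exact: expr_inj (aff_lin_neq0 _) i0_expn _ _.
have lawE n : expect mu n (fun u => (lprod ga u == z)%:R) =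
    iter n (step_law mu ga) (dirac1 R : aff K -> R) z.
  rewrite (expect_lprod mu0 ga n (fun x => (x == z)%:R)) -(tot_law_mul ga mu0 mu1).
  rewrite (@tot_seq _ _ _ [:: z])// ?big_seq1 ?eqxx ?mulr1//.
  by move=> x; rewrite inE; case: (x == z); rewrite // mulr0 eqxx.
have := cesaro_law_le mu1 m_gt0 m_le z ginj N0 L0.
have -> : \sum_(n < 64 ^ j) expect mu n (fun u => (lprod ga u == z)%:R) =
    \sum_(n < 64 ^ j) iter n (step_law mu ga) (dirac1 R : aff K -> R) z.
  by apply: eq_bigr => n _.
set S := \sum_(n < _) _ => H.
have m1 : 0 < m^-1 by rewrite invr_gt0.
have S0 : 0 <= S.
  by apply: sumr_ge0 => n _; have [_ h _] := law_props ga mu0 mu1 n; apply: h.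
have half : 0 <= 2^-1 ^+ j :> R by rewrite exprn_ge0// invr_ge0.
rewrite mulrAC -ler_pdivrMr//.
rewrite -(@ler_pXn2r _ 2%N)// ?nnegrE ?divr_ge0 ?mulr_ge0 ?addr_ge0// ?(ltW m1)//.
apply: le_trans H _.
have -> : (64 ^ j = (4 ^ j) ^ 3)%N by rewrite -expnM mulnC expnM.
set L : R := (4 ^ j)%:R; have Lp : 0 < L by rewrite ltr0n.
have -> : ((1 + m^-1) * 2^-1 ^+ j) ^+ 2 = (1 + m^-1) ^+ 2 * L^-1.
  by rewrite exprMn -exprM mulnC exprM /L natrX -exprVn; congr (_ * _ ^+ _); field.
rewrite natrX -/L.
have -> : L^-1 + L ^+ 2 / (L ^+ 3 * m) = (1 + m^-1) * L^-1.
  by field; rewrite !gt_eqF.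
by rewrite ler_pM2r ?invr_gt0// expr2 ler_peMr ?addr_ge0 ?(ltW m1)// lerDl ltW.
Qed.

Lemma pair_walk_transient :
  ~ {ae P, forall w, infinite_set [set n | aff_lin (pos n w).1 = 1]} ->
  {ae P, forall w, exists n0, forall n, (n0 <= n)%N ->
    free_semigroup (pos n w).1 (pos n w).2}.
Proof.
move=> ntr; have [zs Hzs] := height1_list.
have ntr' : ~ {ae P, forall w, infinite_set [set n | lprod ga (history J n w) = 1%g]}.
  apply: contra_not ntr; apply: filterS => w; congr (infinite_set _).
  apply/seteqP; split => n /=; rewrite -lprod_homothety -/(pos n w).
    by move=> /(congr1 (@aff_lin K)); rewrite aff_lin_homothety// aff_lin_neq0.
  by move=> ->; rewrite [RHS]homothetyE.
have := transient_leaves_list mu0 mu1 Jmeas Jindep zs ntr'.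
apply: filterS2 eventually_height1 => w [n1 H1] [n2 H2].
exists (maxn n1 n2) => n; rewrite geq_max => /andP[nn1 nn2].
apply: contrapT => nf; have := H2 n nn2; rewrite Hzs//.
exact: H1.
Qed.

(** Non-freeness is, from some time [n1] on, a visit to a finite set. *)
Lemma pair_walk_density : {ae P, forall w,
  ((count (fun n => `[< ~ free_semigroup (pos n w).1 (pos n w).2 >])
     (index_iota 1 N.+1))%:R / N%:R : R) @[N --> \oo] --> (0 : R)}.
Proof.
have [zs Hzs] := height1_list.
have Hc j : \sum_(n < 64 ^ j) expect mu n (fun u => (lprod ga u \in zs)%:R) <=
    ((size zs)%:R * (1 + m^-1)) * (64 ^ j)%:R * 2^-1 ^+ j.
  apply: (@le_trans _ _ (\sum_(z <- zs) \sum_(n < 64 ^ j)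
      expect mu n (fun u => (lprod ga u == z)%:R))).
    by rewrite exchange_big/=; apply: ler_sum => n _; apply: expect_mem_le.
  rewrite -!mulrA [leRHS](_ : _ = \sum_(z <- zs) (1 + m^-1) * (64 ^ j)%:R * 2^-1 ^+ j).
    by apply: ler_sum => z _; apply: visit_average_le.
  by rewrite big_const_seq count_predT iter_addr_0 mulr_natl !mulrA.
have := rare_visits mu0 mu1 Jmeas Jindep Hc.
apply: filterS2 eventually_height1 => w [n1 H1] H2; apply: density_cvg0 => t.
have [j0 Hj0] := H2 (2 * t)%N.
exists (maxn j0 (n1 * (2 * t))%N) => j; rewrite geq_max => /andP[jj0 jn].
have := Hj0 j jj0; set V := (\sum_(n < _) _)%N => HV.
have nj : (n1 * (2 * t) < 64 ^ j)%N by apply: leq_ltn_trans jn _; apply: ltn_expl.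
have : (\sum_(n < 64 ^ j) `[< ~ free_semigroup (pos n w).1 (pos n w).2 >] <= n1 + V)%N.
  apply: (@leq_trans (\sum_(n < 64 ^ j) ((n < n1)%N + (lprod ga (history J n w) \in zs)))).
    apply: leq_sum => n _; case: asboolP => // nf.
    case: (ltnP n n1) => [|nn1] //=; rewrite Hzs//; exact: H1.
  rewrite big_split leq_add2r; apply: (@sum_window (fun n => (n < n1)%N)) => a b _ bn _.
  exact: ltn_addl.
move: (\sum_(n < _) _)%N => S SV; move: nj HV SV; move: (64 ^ j)%N => M; nia.
Qed.

Lemma pair_walk_recurrent :
  {ae P, forall w, infinite_set [set n | aff_lin (pos n w).1 = 1]} ->
  {ae P, forall w, infinite_set [set n | ~ free_semigroup (pos n w).1 (pos n w).2]}.
Proof.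
apply: filterS => w; apply: contra_not; apply: sub_finite_set => n /= h.
by apply: not_free_semigroup_lin1; rewrite // -lprod_pair_lin.
Qed.

End PairWalk.

(** * From a finitely supported measure to letters *)

Section Support.
Context (K : fieldType) (R : realType).
Context (eta : probability (aff K * aff K)%type R).

Lemma measurable_pair1 (g : (aff K * aff K)%type) : measurable [set g].
Proof.
rewrite (_ : [set g] = [set g.1] `*` [set g.2]); first exact: measurableX.
by apply/seteqP; split => [_ -> //|[a b] /= [-> ->]]; rewrite -surjective_pairing.
Qed.

Lemma measurable_list (s : seq (aff K * aff K)%type) :
  measurable ([set` s] : set (aff K * aff K)).
Proof.
rewrite (_ : [set` s] = \bigcup_(g in [set` s]) [set g]).
  by apply: fin_bigcup_measurable => [|g _]; [exact: finite_seq | exact: measurable_pair1].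
by apply/seteqP; split => [g ?|_ [g ? ->]//]; exists g.
Qed.

(** A finite set of full measure carries the support, and the rest of it is a finite
union of null singletons. *)
Lemma supp_enum : finitely_supported eta -> exists s : seq (aff K * aff K)%type,
  [/\ uniq s, forall g, g \in s <-> supp eta g & eta (~` [set` s]) = 0%E].
Proof.
move=> [S Sfin [mS S0]].
have /finite_seqP[r rS] := Sfin.
pose s := [seq g <- undup r | eta [set g] != 0%E].
have sE g : g \in s <-> supp eta g.
  rewrite mem_filter mem_undup; split=> [/andP[]//|g0]; apply/andP; split => //.
  apply: contraT => gr; have : (eta [set g] <= eta (~` S))%E.
    apply: le_measure; rewrite ?inE; [exact: measurable_pair1 | exact: measurableC|].
    by move=> _ -> /=; rewrite rS; apply/negP.
  by rewrite S0 measure_le0 => h; rewrite /supp/= h in g0.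
exists s; split => //; first by rewrite filter_uniq ?undup_uniq.
pose r0 := [seq g <- undup r | eta [set g] == 0%E].
have mr : measurable ([set` r0] : set (aff K * aff K)) by exact: measurable_list.
apply/eqP; rewrite -measure_le0.
apply: (@le_trans _ _ (eta (~` S `|` [set` r0]))).
  apply: le_measure; rewrite ?inE.
  - by apply: measurableC; exact: measurable_list.
  - by apply: measurableU => //; exact: measurableC.
  - move=> g /= gs; have [Sg|] := pselect (S g); last by left.
    right; rewrite /= mem_filter mem_undup.
    rewrite rS in Sg; rewrite Sg andbT; apply: contraT => g0.
    by case: gs; rewrite mem_filter g0 mem_undup.
rewrite measureU0 ?S0//; first exact: measurableC.
rewrite (_ : [set` r0] = \bigcup_(g in [set` r0]) [set g]); last first.
  by apply/seteqP; split => [g ?|_ [g ? ->]//]; exists g.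
rewrite measure_fin_bigcup.
- by apply: fsbig1 => g /=; rewrite mem_filter => /andP[/eqP].
- exact: finite_seq.
- by move=> a b _ _ [x /= [<- <-]].
- by move=> g _; exact: measurable_pair1.
Qed.

End Support.

Section Transfer.
Context (K : fieldType) (R : realType).
Context (eta : probability (aff K * aff K)%type R).
Context (d : measure_display) (Omega : measurableType d) (P : probability Omega R).
Context (X : nat -> {RV P >-> (aff K * aff K)%type}).
Hypothesis X_law : forall i B, measurable B -> distribution P (X i) B = eta B.
Hypothesis X_indep : mutually_independent X.
Context (s : seq (aff K * aff K)%type) (us : uniq s) (i0 : 'I_(size s)).
Hypothesis s_null : eta (~` [set` s]) = 0%E.

Let gs (i : 'I_(size s)) := tnth (in_tuple s) i.
(** Steps outside the support, a null event, are read as the letter [i0], so that the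
letters are independent and identically distributed everywhere and not only
almost surely. *)
Definition letter (g : (aff K * aff K)%type) : 'I_(size s) := insubd i0 (index g s).
Let mu i := fine (eta [set gs i]).
Let J n w := letter (X n w).

Lemma letterK g : g \in s -> gs (letter g) = g.
Proof.
move=> gs'; rewrite /gs (tnth_nth g)/= val_insubd index_mem gs'.
exact: nth_index.
Qed.

Lemma gs_mem i : gs i \in s.
Proof. exact: mem_tnth. Qed.

Lemma letter_gs i : letter (gs i) = i.
Proof.
apply: val_inj; rewrite val_insubd index_mem gs_mem.
by rewrite /gs (tnth_nth (gs i)) index_uniq.
Qed.

Lemma mu_EFin i : eta [set gs i] = (mu i)%:E.
Proof. by rewrite fineK// fin_num_measure//; exact: measurable_pair1. Qed.

Lemma letter_preimage i : letter @^-1` [set i] =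
  [set gs i] `|` (if i == i0 then ~` [set` s] else set0).
Proof.
apply/seteqP; split => g /=.
  have [gin|gnin] := boolP (g \in s).
    by move=> <-; left; rewrite letterK.
  have -> : letter g = i0 by rewrite /letter /insubd insubF// index_mem (negPf gnin).
  by move=> <-; right; rewrite eqxx; apply/negP.
move=> [->|]; first exact: letter_gs.
case: eqP => [->|//] /= /negP gnin.
by rewrite /letter /insubd insubF// index_mem (negPf gnin).
Qed.

Lemma measurable_letter i : measurable (letter @^-1` [set i]).
Proof.
rewrite letter_preimage; apply: measurableU; first exact: measurable_pair1.
by case: eqP => // _; apply: measurableC; exact: measurable_list.
Qed.

Lemma eta_letter i : eta (letter @^-1` [set i]) = (mu i)%:E.
Proof.
rewrite letter_preimage -mu_EFin; case: eqP => [_|_]; last by rewrite setU0.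
apply: measureU0 => //; first exact: measurable_pair1.
apply: measurableC; exact: measurable_list.
Qed.

Lemma mu_sum : \sum_i mu i = 1.
Proof.
apply: EFin_inj; rewrite -sumEFin.
under eq_bigr => i _ do rewrite -mu_EFin.
have <- : eta [set` s] = 1%E.
  rewrite -(setCK [set` s]) probability_setC; last by apply: measurableC; exact: measurable_list.
  by rewrite s_null sube0.
rewrite (_ : [set` s] = \bigcup_(i in [set: 'I_(size s)]) [set gs i]); last first.
  apply/seteqP; split => [g gs'|_ [i _ ->]/=]; last exact: gs_mem.
  by exists (letter g) => //=; rewrite letterK.
rewrite measure_fin_bigcup; first by rewrite fsbig_finType.
- exact: finite_finset.
- by move=> i j _ _ [g /= [e1 e2]]; rewrite -(letter_gs i) -e1 e2 letter_gs.
- by move=> i _; exact: measurable_pair1.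
Qed.

Lemma measurable_RV n (B : set (aff K * aff K)%type) : measurable B -> measurable (X n @^-1` B).
Proof.
by move=> mB; rewrite -[X in measurable X]setTI; apply: (measurable_funP (X n)).
Qed.

Lemma J_measurable n i : measurable [set w | J n w = i].
Proof. exact: (measurable_RV n (measurable_letter i)). Qed.

Lemma J_independent (v : seq 'I_(size s)) :
  P [set w | history J (size v) w = v] = (\prod_(i <- v) mu i)%:E.
Proof.
pose F := [fset k | k in iota 0 (size v)]%fset.
have FE k : (k \in F) = (k < size v)%N by rewrite !inE mem_iota.
pose B k : set (aff K * aff K)%type := letter @^-1` [set nth i0 v k].
have mB k : measurable (B k) by exact: measurable_letter.
have -> : [set w | history J (size v) w = v] = \bigcap_(k in [set` F]) (X k @^-1` B k).
  apply/seteqP; split => w /=.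
    move=> hv k /=; rewrite FE => kv; rewrite /B/= -hv.
    by rewrite /history nth_mkseq.
  move=> H; apply: (@eq_from_nth _ i0); rewrite size_history// => k kv.
  by rewrite /history nth_mkseq//; apply: H; rewrite /= FE.
rewrite X_indep; last by move=> k _; exact: mB.
rewrite (perm_big (iota 0 (size v))); last first.
  apply: uniq_perm; rewrite ?fset_uniq ?iota_uniq// => k.
  by rewrite FE mem_iota.
rewrite -prodEFin.
rewrite [in RHS](big_nth i0) big_mkord -[in LHS](subn0 (size v)) -/(index_iota 0 (size v)) big_mkord.
by apply: eq_bigr => k _; rewrite -eta_letter; exact: (X_law k (mB k)).
Qed.

Lemma in_support_ae : {ae P, forall w n, X n w \in s}.
Proof.
have ms : measurable (~` [set` s] : set (aff K * aff K)).
  by apply: measurableC; exact: measurable_list.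
apply/ae_foralln => n; exists (X n @^-1` (~` [set` s])); split.
- exact: (measurable_RV n ms).
- exact: etrans (X_law n ms) s_null.
- by move=> w.
Qed.

Lemma walk_lprod w : (forall n, X n w \in s) ->
  forall n, walk (fun i w => X i w) n w = lprod gs (history J n w).
Proof.
move=> H; elim=> [//|n IH].
by rewrite historyS lprod_rcons -IH /J letterK.
Qed.

End Transfer.

Theorem theorem1p1 (K : fieldType) (R : realType)
    (eta : probability (aff K * aff K)%type R)
    (eta_fin : finitely_supported eta)
    (eta_lin : forall g, supp eta g -> aff_lin g.1 = aff_lin g.2)
    (eta_unity : (eta [set g | is_root_of_unity (aff_lin g.1)] < 1)%E)
    (eta_diag : ~ (supp eta `<=` [set g | g.1 = g.2]))
    (d : measure_display) (Omega : measurableType d) (P : probability Omega R)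
    (X : nat -> {RV P >-> (aff K * aff K)%type})
    (X_law : forall i B, measurable B -> distribution P (X i) B = eta B)
    (X_indep : mutually_independent X) :
  let L := walk (fun i w => X i w) in
  let aL := fun n w => aff_lin (L n w).1 in
  (transient P aL ->
    {ae P, forall w, exists n0 : nat, forall n : nat, (n0 <= n)%N ->
      free_semigroup (L n w).1 (L n w).2})
  /\
  (recurrent P aL ->
    {ae P, forall w,
      infinite_set [set n | ~ free_semigroup (L n w).1 (L n w).2]}
    /\
    {ae P, forall w,
      ((count (fun n => `[< ~ free_semigroup (L n w).1 (L n w).2 >])
         (index_iota 1 N.+1))%:R / N%:R : R) @[N --> \oo] --> (0 : R)}).
Proof.
move=> L aL.
have [s [us sE s0]] := supp_enum eta_fin.
have [g0 g0s g0_unity] : exists2 g, g \in s & ~ is_root_of_unity (aff_lin g.1).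
  apply: contrapT => H; move: eta_unity; rewrite ltNge => /negP; apply.
  have <- : eta [set` s] = 1%E.
    rewrite -(setCK [set` s]) probability_setC; last by apply: measurableC; exact: measurable_list.
    by rewrite s0 sube0.
  apply: le_measure; rewrite ?inE; first exact: measurable_list.
    rewrite (_ : [set g | _] = [set a | is_root_of_unity (aff_lin a)] `*` setT).
      exact: measurableX.
    by apply/seteqP; split => [g /=|g []].
  by move=> g gs; apply: contrapT => ng; apply: H; exists g.
have [g1 g1s g1_diag] : exists2 g, g \in s & g.1 <> g.2.
  apply: contrapT => H; apply: eta_diag => g /sE gs /=.
  by apply: contrapT => ng; apply: H; exists g.
have i0 : 'I_(size s) by exists (index g0 s); rewrite index_mem.
pose gs (i : 'I_(size s)) := tnth (in_tuple s) i.
pose mu i := fine (eta [set gs i]).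
pose J n w := letter i0 (X n w).
have mu_gt0 i : 0 < mu i.
  rewrite lt0r -lee_fin -(mu_EFin eta) measure_ge0 andbT -eqe -(mu_EFin eta).
  by apply/sE; apply: gs_mem.
have mu1 : \sum_i mu i = 1 := mu_sum us i0 s0.
have Jm n i : measurable [set w | J n w = i] by exact: J_measurable.
have Jind (v : seq 'I_(size s)) :
    P [set w | history J (size v) w = v] = (\prod_(i <- v) mu i)%:E.
  exact: J_independent.
have gs_lin i : aff_lin (gs i).1 = aff_lin (gs i).2 by apply/eta_lin/sE/gs_mem.
have u0 : ~ is_root_of_unity (aff_lin (gs (letter i0 g0)).1) by rewrite /gs letterK.
have d1 : (gs (letter i0 g1)).1 <> (gs (letter i0 g1)).2 by rewrite /gs letterK.
have LE : {ae P, forall w n, L n w = lprod gs (history J n w)}.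
  by apply: filterS (in_support_ae X_law s0) => w; exact: walk_lprod.
pose U n w := lprod gs (history J n w).
have aLE w (E : forall n, L n w = U n w) :
    [set n | aL n w = 1] = [set n | aff_lin (U n w).1 = 1].
  by apply/seteqP; split => n /=; rewrite /aL E.
split=> [tr|rec].
  have : {ae P, forall w, exists n0, forall n, (n0 <= n)%N ->
      free_semigroup (U n w).1 (U n w).2}.
    apply: (pair_walk_transient mu_gt0 mu1 Jm Jind gs_lin u0 d1).
    by apply: contra_not tr; apply: filterS2 LE => w E; rewrite aLE.
  by apply: filterS2 LE => w E [n0 H]; exists n0 => n /H; rewrite E.
split.
  have : {ae P, forall w, infinite_set [set n | ~ free_semigroup (U n w).1 (U n w).2]}.
    apply: (pair_walk_recurrent gs_lin).
    by apply: filterS2 LE rec => w E; rewrite aLE.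
  apply: filterS2 LE => w E; congr (infinite_set _).
  by apply/seteqP; split => n /=; rewrite E.
have := pair_walk_density mu_gt0 mu1 Jm Jind gs_lin u0 d1.
apply: filterS2 LE => w E.
rewrite (_ : (fun n => `[< ~ free_semigroup (L n w).1 (L n w).2 >]) =
   (fun n => `[< ~ free_semigroup (U n w).1 (U n w).2 >])) //.
by apply/funext => n; rewrite E.
Qed.
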